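(* Consider the linear regression model $X_i=\beta_0+\beta_1\,i/n+\sigma_ie_i$, $i=1,\ldots,n$, where $\{e_i\}$ satisfies the strong invariance principle with $\Delta_n=n^{1/4}\log(n)$, i.e. there are standard Brownian motions $\{B_t\}$, $\{B_t^*\}$ with $\max_{1\le i\le n}|S_i-\tau B_i|=o_{\mathrm{a.s.}}(\Delta_n)$ and $\max_{1\le i\le n}|S_i^*-\tau^*B_i^*|=o_{\mathrm{a.s.}}(\Delta_n)$. Let $$\hat\beta_1=\frac{n\sum_{i=1}^niX_i-\sum_{i=1}^ni\sum_{i=1}^nX_i}{\sum_{i=1}^ni^2-(\sum_{i=1}^ni)^2/n},\qquad \hat\beta_0=\bar X-\hat\beta_1\frac{n+1}{2n}$$ be the simple linear regression estimates. Let $s_{i,0}=(2n-3i+1)\sigma_i$ and $s_{i,1}=(2i-n-1)\sigma_i$. Assume that for each of the two arrays $s_i=s_{i,0}$ and $s_i=s_{i,1}$, $1\le i\le n$, $$\frac{r_n(s)\Delta_n}{\Sigma_n(s)}+\frac{r_n^*(s)\Delta_n+\Sigma_n^{*2}(s)}{\Sigma_n^2(s)}\to0.$$ Then, as $n\to\infty$, $$\frac{n^2(\hat\beta_0-\beta_0)}{2V_{n,0}}\Rightarrow N(0,\tau^2),\qquad V_{n,0}^2=\sum_{i=1}^n(2n-3i+1)^2(X_i-\hat\beta_0-\hat\beta_1i/n)^2,$$ $$\frac{n^2(\hat\beta_1-\beta_1)}{6V_{n,1}}\Rightarrow N(0,\tau^2),\qquad V_{n,1}^2=\sum_{i=1}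^n(2i-n-1)^2(X_i-\hat\beta_0-\hat\beta_1i/n)^2.$$
   Context: Setting: $\{e_i\}$ is a stationary time series with $E(e_i)=0$, $E(e_i^2)=1$; $\beta_0,\beta_1\in\mathbb{R}$; $\sigma_i>0$ are deterministic constants (which may depend on $n$). $\bar X=n^{-1}\sum_{i=1}^nX_i$. $S_i=\sum_{j=1}^ie_j$, $S_i^*=\sum_{j=1}^i(e_j^2-1)$. $\tau^2$ and $\tau^{*2}$ are the long-run variances of $\{e_i\}$ and $\{e_i^2-1\}$ (assumed well defined), where the long-run variance of a stationary process with autocovariances $\gamma_k$ is $\gamma_0+2\sum_{k\ge1}\gamma_k$; it is assumed that $\tau^2>0$, and $\tau>0$, $\tau^*\ge0$ are the square roots. Strong invariance principles are understood on a possibly enlarged probability space on which the process is redefined without changing its distribution; the two Brownian motions may be defined on different probability spaces. For a real array $s=(s_i)_{1\le i\le n}$: $r_n(s)=|s_n|+\sum_{i=2}^n|s_i-s_{i-1}|$, $r_n^*(s)=|s_n^2|+\sum_{i=2}^n|s_i^2-s_{i-1}^2|$, $\Sigma_n^2(s)=\sum_{i=1}^ns_i^2$, $\Sigma_n^{*2}(s)=\bigl(\sum_{i=1}^ns_i^4\bigr)^{1/2}$. $\Rightarrow$ denotes convergence in distribution.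
   Formalization: The numerator of the slope estimate is corrected from n ΣX_i − Σi ΣX_i to n Σ i X_i − Σi ΣX_i, the least-squares formula; as printed the slope estimate does not estimate β_1 and the conclusion fails. *)

(* Defs.v *)
From HB Require Import structures.
From mathcomp Require Import all_boot all_order all_algebra.
From mathcomp Require Import all_classical all_reals all_analysis.

Set Implicit Arguments.
Unset Strict Implicit.
Unset Printing Implicit Defensive.

Import Order.TTheory GRing.Theory Num.Theory.
Import numFieldNormedType.Exports.

Local Open Scope classical_set_scope.
Local Open Scope ring_scope.

(* Time series and arrays are indexed from 1: the value at index 0 of a
   sequence [nat -> _] is never used. *)

Section Processes.
Context (R : realType).

(* The (k+1)-st to (k+m)-th terms of a process, as a random vector; its law
   lives on the product sigma-algebra of [m.-tuple _]. *)
Definition window (Omega : Type) (e : nat -> Omega -> R) (k m : nat)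
    (w : Omega) : m.-tuple (measurableTypeR R) :=
  [tuple e (k + i).+1 w | i < m].

Definition strictly_stationary d (Omega : measurableType d)
    (P : probability Omega R) (e : nat -> {RV P >-> R}) : Prop :=
  forall (k m : nat) (A : set (m.-tuple (measurableTypeR R))), measurable A ->
    P (window e k m @^-1` A) = P (window e 0 m @^-1` A).

(* Equality of the finite-dimensional distributions of two processes, possibly
   living on different probability spaces. *)
Definition same_law d (Omega : measurableType d) (P : probability Omega R)
    (e : nat -> {RV P >-> R})
    d' (Omega' : measurableType d') (P' : probability Omega' R)
    (e' : nat -> {RV P' >-> R}) : Prop :=
  forall (m : nat) (A : set (m.-tuple (measurableTypeR R))), measurable A ->
    P (window e 0 m @^-1` A) = P' (window e' 0 m @^-1` A).

Definition autocovariance d (Omega : measurableType d)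
    (P : probability Omega R) (X : nat -> Omega -> R) (k : nat) : R :=
  fine (covariance P (X 1) (X k.+1)).

Definition is_long_run_variance d (Omega : measurableType d)
    (P : probability Omega R) (X : nat -> Omega -> R) (v : R) : Prop :=
  (forall i, (1 <= i)%N -> X i \in Lfun P 2%:E) /\
  (autocovariance P X 0 +
     2 * \sum_(1 <= k < n.+1) autocovariance P X k) @[n --> \oo] --> v.

Definition increment d (Omega : measurableType d) (P : probability Omega R)
    (B : R -> {RV P >-> R}) (s t : R) (w : Omega) : R :=
  B t w - B s w.

(* [B t] is only meaningful for [0 <= t].  The Gaussian law is only required
   for [s < t], as [normal_prob m 0] is not the Dirac mass at [m]. *)
Definition standard_brownian_motion d (Omega : measurableType d)
    (P : probability Omega R) (B : R -> {RV P >-> R}) : Prop :=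
  [/\ {ae P, forall w, B 0 w = 0},
      {ae P, forall w, {within `[0, +oo[, continuous (fun t => B t w)}},
      (forall s t : R, 0 <= s -> s < t ->
         forall A : set R, measurable A ->
           P (increment B s t @^-1` A) =
           normal_prob 0 (Num.sqrt (t - s)) A)
    & (forall (k : nat) (t : nat -> R), 0 <= t 0%N ->
         (forall i, (i < k)%N -> t i < t i.+1) ->
         forall A : nat -> set R, (forall i, (i < k)%N -> measurable (A i)) ->
           P (\bigcap_(i < k) (increment B (t i) (t i.+1) @^-1` A i)) =
           (\prod_(i < k) P (increment B (t i) (t i.+1) @^-1` A i))%E)].

(* After redefining the process [e] on another probability space, without
   changing its distribution, the partial sums of [f (e j)] are approximated by
   [tau] times a Brownian motion with an almost sure error o(Delta n). *)
Definition strong_invariance d (Omega : measurableType d)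
    (P : probability Omega R) (e : nat -> {RV P >-> R})
    (f : R -> R) (tau : R) (Delta : nat -> R) : Prop :=
  exists (d' : measure_display) (Omega' : measurableType d')
    (P' : probability Omega' R)
    (e' : nat -> {RV P' >-> R}) (B : R -> {RV P' >-> R}),
  [/\ same_law e e', standard_brownian_motion B &
      {ae P', forall w,
        ((\big[Num.max/0]_(1 <= i < n.+1)
            `|\sum_(1 <= j < i.+1) f (e' j w) - tau * B i%:R w|) / Delta n)
        @[n --> \oo] --> (0 : R)}].

(* Convergence in distribution of real random variables to [mu]: convergence of
   the distribution functions at the continuity points of the limit. *)
Definition cvg_in_distribution d (Omega : measurableType d)
    (P : probability Omega R) (Y : nat -> Omega -> R)
    (mu : set R -> \bar R) : Prop :=
  (forall n, measurable_fun setT (Y n)) /\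
  forall x : R, {for x, continuous (fun y : R => mu `]-oo, y]%classic)} ->
    P (Y n @^-1` `]-oo, x]%classic) @[n --> \oo] --> mu `]-oo, x]%classic.

End Processes.

Section Arrays.
Context (R : realType).
Implicit Types (s : nat -> R) (n : nat).

Definition array_variation s n : R :=
  `|s n| + \sum_(2 <= i < n.+1) `|s i - s i.-1|.

Definition array_variation_sq s n : R :=
  `|s n ^+ 2| + \sum_(2 <= i < n.+1) `|s i ^+ 2 - s i.-1 ^+ 2|.

Definition Sigma_sq s n : R := \sum_(1 <= i < n.+1) s i ^+ 2.

Definition Sigma s n : R := Num.sqrt (Sigma_sq s n).

Definition Sigma_star_sq s n : R :=
  Num.sqrt (\sum_(1 <= i < n.+1) s i ^+ 4).

(* [s n] is the array (s_i), 1 <= i <= n. *)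
Definition array_condition (s : nat -> nat -> R) (Delta : nat -> R) : Prop :=
  (array_variation (s n) n * Delta n / Sigma (s n) n +
     (array_variation_sq (s n) n * Delta n + Sigma_star_sq (s n) n)
       / Sigma_sq (s n) n) @[n --> \oo] --> (0 : R).

Definition rate n : R := n%:R `^ 4^-1 * ln n%:R.

End Arrays.

Section Regression.
Context (R : realType).
Implicit Types (X : nat -> R) (n i : nat).

Definition sample_mean X n : R := (\sum_(1 <= i < n.+1) X i) / n%:R.

(* Least squares for the regressors i / n, 1 <= i <= n. *)
Definition slope_estimate X n : R :=
  (n%:R * (\sum_(1 <= i < n.+1) i%:R * X i)
     - (\sum_(1 <= i < n.+1) i%:R) * (\sum_(1 <= i < n.+1) X i))
  / (\sum_(1 <= i < n.+1) i%:R ^+ 2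
     - (\sum_(1 <= i < n.+1) i%:R) ^+ 2 / n%:R).

Definition intercept_estimate X n : R :=
  sample_mean X n - slope_estimate X n * (n.+1%:R / (2 * n%:R)).

Definition intercept_weight n i : R := 2 * n%:R - 3 * i%:R + 1.

Definition slope_weight n i : R := 2 * i%:R - n%:R - 1.

Definition self_normalizer (c : nat -> nat -> R) X n : R :=
  Num.sqrt (\sum_(1 <= i < n.+1) c n i ^+ 2 *
    (X i - intercept_estimate X n - slope_estimate X n * (i%:R / n%:R)) ^+ 2).

Definition regression_model (Omega : Type) (beta0 beta1 : R)
    (sigma : nat -> nat -> R) (e : nat -> Omega -> R) (n : nat) (w : Omega)
    (i : nat) : R :=
  beta0 + beta1 * (i%:R / n%:R) + sigma n i * e i w.

End Regression.

Arguments rate {R} n.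
Arguments intercept_weight {R} n i.
Arguments slope_weight {R} n i.

(* Main.v *)
Require Import Defs.
From HB Require Import structures.
From mathcomp Require Import all_boot all_order all_algebra.
From mathcomp Require Import all_classical all_reals all_analysis.
From mathcomp Require Import measurable_realfun ring lra.

Set Implicit Arguments.
Unset Strict Implicit.
Unset Printing Implicit Defensive.

Import Order.TTheory GRing.Theory Num.Theory.
Import numFieldNormedType.Exports.

Local Open Scope classical_set_scope.
Local Open Scope ring_scope.

(** The normalized errors of the two least squares estimates are, up to
    deterministic factors tending to 1, weighted sums of the noise divided by
    the self-normalizer: with [s i = c i * sigma i], where [c] is the intercept
    or the slope weight, each statistic is
    [kappa_n * (\sum s i * e i) / V_n] with [kappa_n --> 1]
    ([regression_estimates]).

    Numerator.  Summation by parts ([abel_bound]) turns the strong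
    approximation of the partial sums of the noise into an approximation of
    weighted sums: the weighted sum differs from the same weighted sum of
    Brownian increments by at most the variation of the weights times the
    approximation error, which is negligible with respect to
    [Sigma_n = sqrt (\sum s i ^+ 2)] ([sip_weighted_sum]).  A weighted sum of
    Brownian increments is exactly normal ([brownian_weighted_sum_law]); this
    rests on the convolution formula for normal laws ([normal_convolution]) and
    on an induction that builds the joint law of a partial sum and of the
    increments still to come ([partial_sum_joint_law]).

    Denominator.  The same argument, applied to the centered squares of the
    noise with weights [s i ^+ 2], gives
    [\sum s i ^+ 2 * e i ^+ 2 / Sigma_n ^+ 2 --> 1] in probability
    ([weighted_squares_vanishing]).  Replacing the noise by the residuals adds
    an error governed by [n ^+ 3] times the squared estimation errors over
    [Sigma_n ^+ 2] ([residual_bound]).  As the estimation errors are of order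
    [Sigma_n / n ^+ 2], this is harmless for either weight as soon as the
    ratio of the two values of [Sigma_n ^+ 2] is [o(n)] in either order.  That
    comparison is [Sigma_sq_ratio]: a weight is affine in the index, so it is
    small only at few indices, and these contribute little to the other array by
    the hypothesis on its variation.

    The approximations live on other probability spaces, possibly a different
    one for the noise and for its squares.  Every statistic involved is a
    measurable function of the first [n] terms of the noise, so statements in
    probability and laws are carried back to the original space
    ([vanishing_transport], [bounded_transport], [eq_law_transport]).  The limit
    law is then obtained from two-sided bounds on distribution functions that
    are stable under perturbations vanishing in probability ([cvg_levy]). *)

(** * Convolution of centered normal laws *)

Section Gaussian.
Context (R : realType).
Local Notation mu := (@lebesgue_measure R).
Implicit Types (a c x m s : R) (A : set R).

Lemma measurable_affine x c : measurable_fun setT (fun y : R => x + c * y).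
Proof. by apply: measurable_funD => //; exact: measurable_funM. Qed.

(** Both sides are measures, so half-open intervals suffice.  The two signs of
    [c] are treated apart since the preimage of [ ]a, b] ] is open on the left
    or on the right accordingly. *)
Lemma lebesgue_measure_affine x c : c != 0 -> forall A, measurable A ->
  mu A = (`|c|%:E * mu ((fun y : R => (x + c * y)%R) @^-1` A))%E.
Proof.
move=> c0 A mA.
pose k : {nonneg R} := NngNum (normr_ge0 c).
pose f : measurableTypeR R -> measurableTypeR R := fun y => x + c * y.
have mf : measurable_fun setT f by exact: measurable_affine.
pose nu : {measure set (measurableTypeR R) -> \bar R} :=
  mscale k (pushforward mu f).
rewrite (@lebesgue_measure_unique R (nu mf))//.
move=> X /ocitvP[->|[[a b]/= ab ->]]; first by rewrite !measure0.
rewrite /nu /mscale /= /pushforward /=.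
have cp : 0 < `|c| by rewrite normr_gt0.
have [cgt|clt|] := ltgtP 0 c; last by move/esym/eqP; rewrite (negbTE c0).
- have -> : f @^-1` `]a, b] = `](a - x) / c, (b - x) / c]%classic.
    apply/seteqP; split => y /=; rewrite !in_itv/= ltr_pdivrMr// ler_pdivlMr//;
      rewrite /f; lra.
  rewrite !lebesgue_measure_itv/= !lte_fin ltr_pM2r ?invr_gt0// ltrD2r ab.
  by rewrite -!EFinD -EFinM gtr0_norm//; congr EFin; field.
- have -> : f @^-1` `]a, b] = `[(b - x) / c, (a - x) / c[%classic.
    apply/seteqP; split => y /=; rewrite !in_itv/= ltr_ndivlMr// ler_ndivrMr//;
      rewrite /f; lra.
  rewrite !lebesgue_measure_itv/= !lte_fin ltr_nM2r ?invr_lt0// ltrD2r ab.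
  by rewrite -!EFinD -EFinM ltr0_norm//; congr EFin; field.
Qed.

Lemma ge0_integral_affine x c (f : R -> \bar R) : c != 0 ->
  measurable_fun setT f -> (forall z, (0 <= f z)%E) ->
  (\int[mu]_z f z = `|c|%:E * \int[mu]_y f (x + c * y)%R)%E.
Proof.
move=> c0 mf f0.
pose k : {nonneg R} := NngNum (normr_ge0 c).
pose g : measurableTypeR R -> measurableTypeR R := fun y => x + c * y.
have mg : measurable_fun setT g by exact: measurable_affine.
pose nu : {measure set (measurableTypeR R) -> \bar R} :=
  mscale k (pushforward mu g).
rewrite (eq_measure_integral (nu mg)); last first.
  by move=> A mA _; exact: lebesgue_measure_affine.
rewrite ge0_integral_mscale//; congr (_ * _)%E.
by rewrite ge0_integral_pushforward.
Qed.

(** The density is a Radon-Nikodym derivative, unique almost everywhere. *)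
Lemma integral_normal_prob m s (f : R -> \bar R) : s != 0 ->
  (normal_prob m s).-integrable setT f ->
  (\int[normal_prob m s]_x f x = \int[mu]_x (f x * (normal_pdf m s x)%:E))%E.
Proof.
move=> s0 fint; have mf := measurable_int _ fint.
rewrite -(Radon_Nikodym_change_of_variables (normal_prob_dominates m s))//=.
apply: ae_eq_integral => //.
- apply: emeasurable_funM => //; apply: (measurable_int mu).
  by apply: Radon_Nikodym_integrable; exact: normal_prob_dominates.
- apply: emeasurable_funM => //=; apply/measurableT_comp => //=.
  exact: measurable_normal_pdf.
- apply: ae_eqe_mul2l => /=.
  rewrite Radon_NikodymE//=; first exact: normal_prob_dominates.
  move=> dom; case: cid => /= h [h1 h2 h3].
  apply: integral_ae_eq => //=.
  + by apply/measurableT_comp => //; exact: measurable_normal_pdf.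
  + by move=> E _ mE; rewrite -h3.
Qed.

(** Completing the square: for [x] of law [N(0, a^2)] and [z] of law
    [N(x, c^2)] given [x], the joint density is rewritten as the density of [z]
    times the density of [x] given [z]. *)
Lemma normal_pdf_split x z a c : a != 0 -> c != 0 ->
  let v := Num.sqrt (a ^+ 2 + c ^+ 2) in
  normal_pdf x c z * normal_pdf 0 a x =
  normal_pdf 0 v z * normal_pdf (z * a ^+ 2 / v ^+ 2) (a * c / v) x.
Proof.
move=> a0 c0 v.
have a2 : 0 < a ^+ 2 by rewrite exprn_even_gt0.
have c2 : 0 < c ^+ 2 by rewrite exprn_even_gt0.
have v2 : v ^+ 2 = a ^+ 2 + c ^+ 2 by rewrite sqr_sqrtr// addr_ge0// ltW.
have vp : 0 < v by rewrite sqrtr_gt0 addr_gt0.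
have v0 : v != 0 by rewrite gt_eqF.
have w0 : a * c / v != 0 by rewrite !mulf_neq0// invr_neq0.
have vv0 : a ^+ 2 + c ^+ 2 != 0 by rewrite gt_eqF// addr_gt0.
have pk : normal_peak c * normal_peak a =
          normal_peak v * normal_peak (a * c / v).
  rewrite /normal_peak -2!invfM -2?sqrtrM; last 2 first.
  - by rewrite pmulrn_lge0// mulr_ge0 ?sqr_ge0 ?pi_ge0.
  - by rewrite pmulrn_lge0// mulr_ge0 ?sqr_ge0 ?pi_ge0.
  by congr (Num.sqrt _)^-1; field.
have fn : normal_fun x c z * normal_fun 0 a x =
          normal_fun 0 v z * normal_fun (z * a ^+ 2 / v ^+ 2) (a * c / v) x.
  rewrite /normal_fun -!expRD; congr expR.
  rewrite !expr_div_n !exprMn v2; field.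
  by rewrite vv0 c0 a0.
by rewrite !normal_pdfE// mulrACA pk fn mulrACA.
Qed.

Lemma normal_pdf_shift x c z : c != 0 ->
  normal_pdf x c z = normal_pdf 0 c (z - x).
Proof. by move=> c0; rewrite !normal_pdfE// /normal_fun subr0. Qed.

Lemma normal_pdf_scale x c y : c != 0 ->
  `|c| * normal_pdf x c (x + c * y) = normal_pdf 0 1 y.
Proof.
move=> c0; rewrite !normal_pdfE ?oner_neq0// mulrA; congr (_ * _).
  rewrite /normal_peak expr1n mul1r -mulrnAr sqrtrM ?sqr_ge0// sqrtr_sqr invfM.
  by rewrite mulrA divff ?mul1r// normr_eq0.
by rewrite /normal_fun; congr expR; field.
Qed.

Lemma measurable_restrict_normal_pdf m s A : measurable A ->
  measurable_fun setT ((fun x => (normal_pdf m s x)%:E) \_ A).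
Proof.
move=> mA; rewrite epatch_indic; apply: emeasurable_funM.
  by apply/measurable_EFinP; exact: measurable_normal_pdf.
by apply/measurable_EFinP; exact: measurable_indic.
Qed.

Lemma normal_prob_affine x c A : c != 0 -> measurable A ->
  normal_prob 0 1 [set y | A (x + c * y)] = normal_prob x c A.
Proof.
move=> c0 mA; rewrite /normal_prob integral_mkcond [RHS]integral_mkcond.
rewrite [RHS](@ge0_integral_affine x c)//; last 2 first.
- exact: measurable_restrict_normal_pdf.
- by move=> z; rewrite patchE; case: ifP; rewrite // lee_fin normal_pdf_ge0.
rewrite -ge0_integralZl//; last 2 first.
- apply: (@measurableT_comp _ _ _ _ _ _ (_ \_ A)); last first.
    exact: measurable_affine.
  exact: measurable_restrict_normal_pdf.
- by move=> z; rewrite patchE; case: ifP; rewrite // lee_fin normal_pdf_ge0.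
apply: eq_integral => y _; rewrite !patchE.
have -> : (y \in [set y | A (x + c * y)]) = (x + c * y \in A).
  by apply/idP/idP; rewrite !inE.
by case: ifP => _; rewrite ?mule0// -EFinM normal_pdf_scale.
Qed.

(** By Tonelli one may integrate in [x] first; after [normal_pdf_split] the
    inner integral is the total mass of a normal density. *)
Lemma normal_convolution a c A : a != 0 -> c != 0 -> measurable A ->
  (normal_prob 0 a \x normal_prob 0 1)%E
    ((fun p : R * R => p.1 + c * p.2) @^-1` A) =
  normal_prob 0 (Num.sqrt (a ^+ 2 + c ^+ 2)) A.
Proof.
move=> a0 c0 mA; set v := Num.sqrt _; set C := _ @^-1` A.
have mC : measurable C.
  rewrite -[C]setTI; apply: (_ : measurable_fun setT _) => //.
  by apply: measurable_funD => //; apply: measurable_funM.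
have mpdf m s : measurable_fun setT (@normal_pdf R m s).
  exact: measurable_normal_pdf.
have secE x : normal_prob 0 1 (xsection C x) = normal_prob x c A.
  rewrite -(@normal_prob_affine x c)//; congr (normal_prob _ _ _).
  by apply/seteqP; split => y; rewrite xsectionE.
rewrite /product_measure1 /=.
transitivity (\int[normal_prob 0 a]_x (normal_prob x c A))%E.
  by apply: eq_integral => x _; exact: secE.
rewrite integral_normal_prob//; last first.
  apply/integrableP; split.
    rewrite -(funext secE); exact: measurable_fun_xsection.
  apply: (@le_lt_trans _ _ (\int[normal_prob 0 a]_x (cst 1%E x))%E); last first.
    rewrite integral_cst// mul1e; apply: le_lt_trans (ltry 1).
    exact: (probability_le1 (normal_prob 0 a)).
  apply: ge0_le_integral => //=.
  - apply: measurableT_comp => //.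
    rewrite -(funext secE); exact: measurable_fun_xsection.
  - by move=> x _; rewrite gee0_abs// probability_le1.
pose f (p : R * R) : \bar R :=
  (normal_pdf 0 c (p.2 - p.1) * normal_pdf 0 a p.1 * \1_A p.2)%:E.
have mf : measurable_fun setT f.
  apply/measurable_EFinP; apply: measurable_funM; last first.
    by apply: (@measurableT_comp _ _ _ _ _ _ (\1_A : R -> R)) => //.
  apply: measurable_funM; last exact: (measurableT_comp (mpdf _ _)).
  by apply: (measurableT_comp (mpdf _ _)); exact: measurable_funB.
have f0 p : (0 <= f p)%E.
  by rewrite lee_fin !mulr_ge0// ?normal_pdf_ge0// indicE.
transitivity (\int[mu]_x \int[mu]_z f (x, z))%E.
  apply: eq_integral => x _; rewrite /normal_prob integral_mkcond.
  rewrite -ge0_integralZr//.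
  - apply: eq_integral => z _; rewrite patchE /f indicE.
    by case: ifP => _; rewrite ?mulr0 ?mul0e// mulr1 EFinM -normal_pdf_shift.
  - exact: measurable_restrict_normal_pdf.
  - by move=> z; rewrite patchE; case: ifP; rewrite // lee_fin normal_pdf_ge0.
  - by rewrite lee_fin normal_pdf_ge0.
transitivity (\int[mu]_z \int[mu]_x f (x, z))%E; first exact: fubini_tonelli.
rewrite /normal_prob [RHS]integral_mkcond; apply: eq_integral => z _.
rewrite patchE; have [zA|zA] := boolP (z \in A); last first.
  by rewrite integral0_eq// => x _; rewrite /f indicE (negbTE zA) mulr0.
under eq_integral.
  move=> x _; rewrite /f/= indicE zA mulr1 -normal_pdf_shift//.
  rewrite normal_pdf_split// EFinM; over.
rewrite ge0_integralZl//.
- by rewrite integral_normal_pdf mule1.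
- by apply/measurable_EFinP; exact: mpdf.
- by move=> x _; rewrite lee_fin normal_pdf_ge0.
- by rewrite lee_fin normal_pdf_ge0.
Qed.
End Gaussian.

(** * Weighted sums of independent standard normal variables *)

Section GaussianSums.
Context (R : realType).
Implicit Types (A : set R) (v c : R).

(** The value at [v = 0] is a Dirac mass because [normal_prob 0 0] is the
    uniform law on the unit interval; this lets a partial sum start at 0 and
    some weights be zero. *)
Definition centered_normal v : probability (measurableTypeR R) R :=
  if v == 0 then (\d_(0 : measurableTypeR R) : probability _ R)
  else (normal_prob 0 (Num.sqrt v) : probability _ R).

Lemma normal_prob_abs m c A : normal_prob m `|c| A = normal_prob m c A.
Proof.
rewrite /normal_prob; apply: eq_integral => x _.
by rewrite /normal_pdf normr_eq0 /normal_peak /normal_fun real_normK ?num_real.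
Qed.

Lemma centered_normal_convolution v c A : 0 <= v -> measurable A ->
  (centered_normal v \x normal_prob 0 1)%E
    ((fun p : R * R => p.1 + c * p.2) @^-1` A) = centered_normal (v + c ^+ 2) A.
Proof.
move=> v0 mA; have [->|c0] := eqVneq c 0.
  rewrite expr0n/= addr0 (_ : _ @^-1` A = A `*` setT); last first.
    by apply/seteqP; split => -[x y]/=; rewrite mul0r addr0// => -[].
  rewrite product_measure1E//.
  rewrite -[RHS]mule1; congr (_ * _)%E.
  exact: (probability_setT (normal_prob 0 1)).
have c2 : 0 < c ^+ 2 by rewrite exprn_even_gt0.
have -> : centered_normal (v + c ^+ 2) = normal_prob 0 (Num.sqrt (v + c ^+ 2)).
  by rewrite /centered_normal gt_eqF// ltr_wpDl.
have [->|v1] := eqVneq v 0; last first.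
  have a0 : Num.sqrt v != 0 by rewrite gt_eqF// sqrtr_gt0 lt_neqAle eq_sym v1.
  rewrite /centered_normal (negbTE v1) -[in RHS](sqr_sqrtr v0).
  exact: normal_convolution.
rewrite add0r sqrtr_sqr.
transitivity (normal_prob 0 c A); last exact/esym/normal_prob_abs.
rewrite /centered_normal eqxx.
rewrite /product_measure1 integral_dirac//; last first.
  apply: measurable_fun_xsection.
  rewrite -[X in measurable X]setTI; apply: (_ : measurable_fun setT _) => //.
  by apply: measurable_funD => //; apply: measurable_funM.
rewrite diracT mul1e /= -(@normal_prob_affine _ 0 c)//.
by congr (normal_prob _ _ _); apply/seteqP; split => y; rewrite xsectionE.
Qed.

(** Rectangles form a pi-system that generates the product sigma-algebra and
    contains the whole space. *)
Lemma eq_measure_rectangles d1 d2 (T1 : measurableType d1)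
    (T2 : measurableType d2) (m1 m2 : {measure set (T1 * T2) -> \bar R}) :
  (m1 setT < +oo)%E ->
  (forall (A : set T1) (B : set T2), measurable A -> measurable B ->
     m1 (A `*` B) = m2 (A `*` B)) ->
  forall C, measurable C -> m1 C = m2 C.
Proof.
move=> fin m12 C mC.
apply: (measure_unique
  [set (A : set T1) `*` (B : set T2) | A in measurable & B in measurable]
  (fun=> setT)) => //.
- by rewrite measurable_prod_measurableType.
- move=> _ _ [A mA [B mB <-]] [A' mA' [B' mB' <-]]; rewrite -setXI.
  exists (A `&` A'); first exact: measurableI.
  by exists (B `&` B') => //; exact: measurableI.
- by move=> _; exists setT => //; exists setT => //; rewrite setXTT.
- by rewrite bigcup_const.
- by move=> _ [A mA [B mB <-]]; exact: m12.
Qed.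

Context d (Omega : measurableType d) (P : probability Omega R).
Variables (Z : nat -> Omega -> R) (k : nat).
Hypothesis mZ : forall i, measurable_fun setT (Z i).
Hypothesis Z_law : forall i, (i < k)%N -> forall A, measurable A ->
  P (Z i @^-1` A) = normal_prob 0 1 A.
Hypothesis Z_indep : forall A : nat -> set R,
  (forall i, (i < k)%N -> measurable (A i)) ->
  P (\bigcap_(i < k) (Z i @^-1` A i)) = (\prod_(i < k) P (Z i @^-1` A i))%E.

Lemma fine_normal_prob m s A : measurable A ->
  (fine (normal_prob m s A))%:E = normal_prob m s A.
Proof. by move=> mA; rewrite fineK// (fin_num_measure (normal_prob m s)). Qed.

(** Independence is only known as a product rule for events on the individual
    variables.  Keeping the variables of index [>= j] in the event makes the
    induction on [j] possible: absorbing [Z j] into the partial sum only needs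
    the law of the pair formed by the partial sum and [Z j], restricted to an
    event on the remaining variables. *)
Lemma partial_sum_joint_law (c : nat -> R) j (A : set R) (E : nat -> set R) :
  (j <= k)%N -> measurable A -> (forall i, measurable (E i)) ->
  P ([set w | A (\sum_(i < j) c i * Z i w)] `&`
     \bigcap_(i in [set i | (j <= i < k)%N]) (Z i @^-1` E i)) =
  (centered_normal (\sum_(i < j) c i ^+ 2) A *
   (\prod_(j <= i < k) fine (normal_prob 0 1 (E i)))%:E)%E.
Proof.
have mpre i B : measurable B -> measurable (Z i @^-1` B).
  by move=> mB; rewrite -[_ @^-1` _]setTI; exact: mZ.
elim: j A E => [|j IH] A E jk mA mE.
  have -> : centered_normal (\sum_(i < 0) c i ^+ 2) A = (0 \in A)%:R%:E.
    by rewrite big_ord0 /centered_normal eqxx; exact: diracE.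
  have -> : [set w | A (\sum_(i < 0) c i * Z i w)] = [set w | A 0].
    by apply/seteqP; split => w /=; rewrite big_ord0.
  have -> : \bigcap_(i in [set i | (0 <= i < k)%N]) (Z i @^-1` E i) =
            \bigcap_(i < k) (Z i @^-1` E i) by [].
  have prodE : P (\bigcap_(i < k) (Z i @^-1` E i)) =
      (\prod_(0 <= i < k) fine (normal_prob 0 1 (E i)))%:E.
    rewrite Z_indep// big_mkord -prodEFin; apply: eq_bigr => i _.
    by rewrite Z_law// fine_normal_prob.
  have [A0|A0] := boolP (0 \in A); rewrite /= ?mul1e ?mul0e.
    rewrite (_ : [set w | A 0] = setT) ?setTI// -subTset => w _ /=.
    by rewrite inE in A0.
  rewrite (_ : [set w | A 0] = set0) ?set0I ?measure0// -subset0 => w /= A0'.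
  by move/negP: A0; apply; rewrite inE.
pose F := \bigcap_(i in [set i | (j.+1 <= i < k)%N]) (Z i @^-1` E i).
have mF : measurable F by apply: bigcap_measurableType => i _; exact: mpre.
pose S w := \sum_(i < j) c i * Z i w.
have mS : measurable_fun setT S.
  by apply: measurable_sum => i; apply: measurable_funM.
pose g w : measurableTypeR R * measurableTypeR R := (S w, Z j w).
have mg : measurable_fun setT g.
  by apply: measurable_fun_pair; [exact: mS|exact: mZ].
pose q := \prod_(j.+1 <= i < k) fine (normal_prob 0 1 (E i)).
have q0 : 0 <= q.
  by apply: prodr_ge0 => i _; rewrite fine_ge0//; exact: measure_ge0.
pose v := \sum_(i < j) c i ^+ 2.
(* [nu1] is the law of the pair [g] on the event [F]; the induction hypothesis
   says that it is [q] times a product measure on rectangles. *)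
pose nu1 := (pushforward (mrestr P mF) g : {measure set _ -> \bar R}).
pose nu2 := (mscale (NngNum q0) (centered_normal v \x normal_prob 0 1)%E
  : {measure set _ -> \bar R}).
have rect : forall C, measurable C -> nu1 mg C = nu2 C.
  apply: eq_measure_rectangles.
    apply: (@le_lt_trans _ _ 1%E); last by rewrite ltry.
    rewrite /nu1 /= /pushforward /mrestr preimage_setT setTI.
    exact: probability_le1.
  move=> B1 B2 mB1 mB2.
  rewrite /nu1 /nu2 /= /pushforward /mrestr /mscale /=.
  rewrite product_measure1E//.
  pose E' i := if i == j then B2 else E i.
  have mE' i : measurable (E' i).
    by rewrite /E'; case: ifP => _; [exact: mB2|exact: mE].
  have -> : g @^-1` (B1 `*` B2) `&` F = [set w | B1 (S w)] `&`
      \bigcap_(i in [set i | (j <= i < k)%N]) (Z i @^-1` E' i).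
    apply/seteqP; split => w /=.
      move=> [[gB1 gB2] Fw]; split=> // i /= /andP[ji ik].
      rewrite /E'; case: eqP => [->//|/eqP ij].
      by apply: Fw; rewrite /= ik ltn_neqAle eq_sym ij ji.
    move=> [SB1 ZE]; split.
      by split=> //; have := ZE j; rewrite /= leqnn jk /E' eqxx; exact.
    move=> i /= /andP[ji ik]; have := ZE i; rewrite /= (ltnW ji) ik /E'.
    by rewrite gtn_eqF//; exact.
  rewrite IH//; last exact: ltnW.
  rewrite big_ltn// {1}/E' eqxx EFinM fine_normal_prob// muleA [RHS]muleC.
  congr (_ * _%:E)%E; apply: eq_big_nat => i /andP[ji _].
  by rewrite /E' gtn_eqF.
have -> : [set w | A (\sum_(i < j.+1) c i * Z i w)] `&` F =
    g @^-1` ((fun p : R * R => p.1 + c j * p.2) @^-1` A) `&` F.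
  by congr (_ `&` _); apply/seteqP; split => w /=; rewrite big_ord_recr.
have mC : measurable ((fun p : R * R => p.1 + c j * p.2) @^-1` A).
  rewrite -[X in measurable X]setTI; apply: (_ : measurable_fun setT _) => //.
  by apply: measurable_funD => //; apply: measurable_funM.
transitivity (nu2 ((fun p : R * R => p.1 + c j * p.2) @^-1` A)).
  exact: rect.
rewrite /nu2 /= /mscale /= centered_normal_convolution ?sumr_ge0//; last first.
  by move=> i _; rewrite sqr_ge0.
by rewrite muleC big_ord_recr.
Qed.

Lemma gaussian_sum_law (c : nat -> R) (A : set R) :
  0 < \sum_(i < k) c i ^+ 2 -> measurable A ->
  P [set w | A (\sum_(i < k) c i * Z i w)] =
  normal_prob 0 (Num.sqrt (\sum_(i < k) c i ^+ 2)) A.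
Proof.
move=> c0 mA; have := @partial_sum_joint_law c k A (fun=> setT) (leqnn k) mA.
rewrite big_geq// mule1 /centered_normal (gt_eqF c0) => <-//.
rewrite (_ : \bigcap_(i in _) _ = setT) ?setIT//.
by rewrite -subTset => w _ i.
Qed.
End GaussianSums.

(** * Convergence and boundedness in probability *)

Section InProbability.
Context (R : realType) d (Omega : measurableType d) (P : probability Omega R).
Implicit Types (A B : set Omega) (eta : R) (Y Z : nat -> Omega -> R).

(** The exceptional set [E] is measurable but [A] need not be, so that
    pointwise inequalities between random quantities can be used freely. *)
Definition holds_up_to A eta : Prop :=
  exists E, [/\ measurable E, (P E <= eta%:E)%E & ~` E `<=` A].

Definition vanishing_in_prob Z : Prop := forall eps eta, 0 < eps -> 0 < eta ->
  \forall n \near \oo, holds_up_to [set w | `|Z n w| <= eps] eta.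

Definition bounded_in_prob Z : Prop := forall eta, 0 < eta ->
  exists2 M, 0 < M &
    \forall n \near \oo, holds_up_to [set w | `|Z n w| <= M] eta.

Lemma holds_up_toS A B eta :
  A `<=` B -> holds_up_to A eta -> holds_up_to B eta.
Proof. by move=> AB [E [mE PE EA]]; exists E; split=> // w /EA /AB. Qed.

Lemma holds_up_toI A B eta1 eta2 :
  holds_up_to A eta1 -> holds_up_to B eta2 ->
  holds_up_to (A `&` B) (eta1 + eta2).
Proof.
move=> [E [mE PE EA]] [F [mF PF FB]]; exists (E `|` F); split.
- exact: measurableU.
- by rewrite EFinD; apply: le_trans (measureU2 _ mE mF) _; apply: leeD.
- by move=> w /not_orP[Ew Fw]; split; [exact: EA|exact: FB].
Qed.

Lemma holds_up_to_le A B C eta : measurable B -> measurable C ->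
  B `&` A `<=` C -> holds_up_to A eta -> (P B <= P C + eta%:E)%E.
Proof.
move=> mB mC BAC [E [mE PE EA]].
apply: (@le_trans _ _ (P (C `|` E))).
  apply: le_measure; rewrite ?inE//; first exact: measurableU.
  move=> w Bw; have [Ew|/EA Aw] := pselect (E w); first by right.
  by left; apply: BAC.
by apply: le_trans (measureU2 _ mC mE) _; apply: leeD.
Qed.

Lemma le_vanishing Y Z :
  (\forall n \near \oo, forall w, `|Z n w| <= `|Y n w|) ->
  vanishing_in_prob Y -> vanishing_in_prob Z.
Proof.
move=> ZY Y0 eps eta eps0 eta0; near=> n.
have : holds_up_to [set w | `|Y n w| <= eps] eta by near: n; exact: Y0.
apply: holds_up_toS => w /=; apply: le_trans.
by move: w; near: n.
Unshelve. all: by end_near. Qed.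

Lemma vanishingD Y Z : vanishing_in_prob Y -> vanishing_in_prob Z ->
  vanishing_in_prob (fun n w => Y n w + Z n w).
Proof.
move=> Y0 Z0 eps eta eps0 eta0; near=> n.
rewrite [eta]splitr.
have YE : holds_up_to [set w | `|Y n w| <= eps / 2] (eta / 2).
  by near: n; apply: Y0; rewrite divr_gt0.
have ZE : holds_up_to [set w | `|Z n w| <= eps / 2] (eta / 2).
  by near: n; apply: Z0; rewrite divr_gt0.
apply: holds_up_toS (holds_up_toI YE ZE) => w [/= Yw Zw].
by rewrite [eps]splitr (le_trans (ler_normD _ _))// lerD.
Unshelve. all: by end_near. Qed.

Lemma vanishingM Y Z : vanishing_in_prob Y -> bounded_in_prob Z ->
  vanishing_in_prob (fun n w => Y n w * Z n w).
Proof.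
move=> Y0 Zb eps eta eps0 eta0.
have eta2 : 0 < eta / 2 by rewrite divr_gt0.
have [M M0 ZM] := Zb _ eta2; near=> n.
rewrite [eta]splitr.
have YE : holds_up_to [set w | `|Y n w| <= eps / M] (eta / 2).
  by near: n; apply: Y0; rewrite ?divr_gt0.
have ZE : holds_up_to [set w | `|Z n w| <= M] (eta / 2) by near: n.
apply: holds_up_toS (holds_up_toI YE ZE) => w [/= Yw Zw].
by rewrite normrM -[eps](divfK (lt0r_neq0 M0)) ler_pM.
Unshelve. all: by end_near. Qed.

Lemma boundedM Y Z : bounded_in_prob Y -> bounded_in_prob Z ->
  bounded_in_prob (fun n w => Y n w * Z n w).
Proof.
move=> Yb Zb eta eta0; have eta2 : 0 < eta / 2 by rewrite divr_gt0.
have [M M0 YM] := Yb _ eta2; have [N N0 ZN] := Zb _ eta2.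
exists (M * N); first exact: mulr_gt0.
near=> n; rewrite [eta]splitr.
have YE : holds_up_to [set w | `|Y n w| <= M] (eta / 2) by near: n.
have ZE : holds_up_to [set w | `|Z n w| <= N] (eta / 2) by near: n.
apply: holds_up_toS (holds_up_toI YE ZE) => w [/= Yw Zw].
by rewrite normrM ler_pM.
Unshelve. all: by end_near. Qed.

Lemma boundedD_vanishing Y Z : bounded_in_prob Y -> vanishing_in_prob Z ->
  bounded_in_prob (fun n w => Y n w + Z n w).
Proof.
move=> Yb Z0 eta eta0; have eta2 : 0 < eta / 2 by rewrite divr_gt0.
have [M M0 YM] := Yb _ eta2.
exists (M + 1); first by rewrite ltr_wpDr.
near=> n; rewrite [eta]splitr.
have YE : holds_up_to [set w | `|Y n w| <= M] (eta / 2) by near: n.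
have ZE : holds_up_to [set w | `|Z n w| <= 1] (eta / 2).
  by near: n; apply: Z0.
apply: holds_up_toS (holds_up_toI YE ZE) => w [/= Yw Zw].
by rewrite (le_trans (ler_normD _ _))// lerD.
Unshelve. all: by end_near. Qed.

Lemma vanishing_cst (a : nat -> R) : a @ \oo --> 0 ->
  vanishing_in_prob (fun n _ => a n).
Proof.
move=> /cvgr0Pnorm_le a0 eps eta eps0 eta0; near=> n.
exists set0; split=> //; first by rewrite measure0 lee_fin ltW.
by move=> w _ /=; near: n; exact: a0.
Unshelve. all: by end_near. Qed.

Lemma vanishing_bounded Z : vanishing_in_prob Z -> bounded_in_prob Z.
Proof. by move=> Z0 eta eta0; exists 1 => //; exact: Z0. Qed.

Lemma bounded_in_prob_cst c : bounded_in_prob (fun _ _ => c).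
Proof.
move=> eta eta0; exists (`|c| + 1); first by rewrite ltr_wpDl.
near=> n; exists set0; split=> //; first by rewrite measure0 lee_fin ltW.
by move=> w _ /=; rewrite lerDl.
Unshelve. all: by end_near. Qed.

(** Egorov: almost sure convergence is uniform off a set of small
    probability. *)
Lemma vanishing_ae Z : (forall n, measurable_fun setT (Z n)) ->
  {ae P, forall w, Z n w @[n --> \oo] --> 0} -> vanishing_in_prob Z.
Proof.
move=> mZ Z0 eps eta eps0 eta0.
have [||||||E [mE PE EZ]] := @ae_pointwise_almost_uniform _ R Omega P Z (cst 0)
  setT eta => //.
- exact: le_lt_trans (probability_le1 _ _) (ltry _).
- by apply: filterS Z0 => w Zw _.
have nearE : \forall n \near \oo, forall w, (setT `\` E) w -> `|Z n w| <= eps.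
  apply: (EZ [set h | forall w, (setT `\` E) w -> `|h w| <= eps]).
  apply/uniform_nbhs; exists [set xy : R * R | ball xy.1 eps xy.2]; split.
    exact: entourage_ball (PosNum eps0).
  move=> h /= hE w Ew; have := hE w Ew.
  by rewrite /ball/= sub0r normrN => /ltW.
near=> n; exists E; split=> //; first exact: ltW.
move=> w Ew /=; move: w Ew; near: n.
by apply: filterS nearE => n nE w Ew; exact: nE.
Unshelve. all: by end_near. Qed.

End InProbability.

(** * Two-sided bounds on distribution functions *)

Section Levy.
Context (R : realType) (mu : probability (measurableTypeR R) R).

(** Convergence to [mu] for the Levy distance.  Unlike pointwise convergence of
    distribution functions, it is preserved by perturbations that vanish in
    probability without any knowledge of the continuity points of the limit. *)
Definition cvg_levy d (Omega : measurableType d) (P : probability Omega R)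
    (Y : nat -> Omega -> R) : Prop :=
  forall delta eta : R, 0 < delta -> 0 < eta -> \forall n \near \oo, forall x,
    (P (Y n @^-1` `]-oo, x]%classic) <=
       mu `]-oo, (x + delta)%R]%classic + eta%:E)%E /\
    (mu `]-oo, (x - delta)%R]%classic <=
       P (Y n @^-1` `]-oo, x]%classic) + eta%:E)%E.

Lemma cvg_levy_law d (Omega : measurableType d) (P : probability Omega R)
    (Y : nat -> Omega -> R) :
  (\forall n \near \oo, forall A, measurable A -> P (Y n @^-1` A) = mu A) ->
  cvg_levy P Y.
Proof.
move=> YE delta eta delta0 eta0; apply: filterS YE => n YE x.
have mono (y z : R) :
    y <= z -> (mu `]-oo, y]%classic <= mu `]-oo, z]%classic)%E.
  by move=> yz; apply: le_measure; rewrite ?inE//; exact: subset_itvl.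
have eta0E : (0 <= eta%:E)%E by rewrite lee_fin ltW.
rewrite YE//; split; apply: (le_trans _ (leeDl _ eta0E)); apply: mono.
- by rewrite lerDl ltW.
- by rewrite gerBl ltW.
Qed.

Lemma cvg_levy_eq_law d (Omega : measurableType d) (P : probability Omega R)
    d' (Omega' : measurableType d') (P' : probability Omega' R)
    (Y : nat -> Omega -> R) (Y' : nat -> Omega' -> R) :
  (forall n A, measurable A -> P (Y n @^-1` A) = P' (Y' n @^-1` A)) ->
  cvg_levy P' Y' -> cvg_levy P Y.
Proof.
move=> YY' Y'mu delta eta delta0 eta0.
by apply: filterS (Y'mu _ _ delta0 eta0) => n Yn x; rewrite YY'.
Qed.

(** [Z n <= x] forces [Y n <= x + delta / 2] off the exceptional set, and
    conversely; the other half of [delta] is spent on the bounds for [Y]. *)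
Lemma cvg_levy_vanishing d (Omega : measurableType d) (P : probability Omega R)
    (Y Z : nat -> Omega -> R) : (forall n, measurable_fun setT (Y n)) ->
  (forall n, measurable_fun setT (Z n)) ->
  vanishing_in_prob P (fun n w => Z n w - Y n w) ->
  cvg_levy P Y -> cvg_levy P Z.
Proof.
move=> mY mZ ZY Ymu delta eta delta0 eta0.
have mpre (X : nat -> Omega -> R) n y : (forall n, measurable_fun setT (X n)) ->
    measurable (X n @^-1` `]-oo, y]).
  by move=> mX; rewrite -[_ @^-1` _]setTI; exact: mX.
have delta2 : 0 < delta / 2 by rewrite divr_gt0.
have eta2 : 0 < eta / 2 by rewrite divr_gt0.
near=> n => x.
have close : holds_up_to P [set w | `|Z n w - Y n w| <= delta / 2] (eta / 2).
  by near: n; exact: ZY.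
have Yn : forall x,
    (P (Y n @^-1` `]-oo, x]%classic) <=
      mu `]-oo, (x + delta / 2)%R]%classic + (eta / 2)%:E)%E /\
    (mu `]-oo, (x - delta / 2)%R]%classic <=
      P (Y n @^-1` `]-oo, x]%classic) + (eta / 2)%:E)%E.
  by near: n; exact: Ymu.
rewrite [eta in X in X /\ _]splitr [eta in X in _ /\ X]splitr !EFinD; split.
- apply: (@le_trans _ _
    (P (Y n @^-1` `]-oo, (x + delta / 2)%R]) + (eta / 2)%:E)%E).
    apply: (holds_up_to_le _ _ _ close); try exact: mpre.
    move=> w []/=; rewrite !in_itv/= ler_distl => Zx /andP[YZ _]; lra.
  rewrite addeA leeD2r//.
  by have [+ _] := Yn (x + delta / 2); rewrite -addrA -splitr.
- apply: (@le_trans _ _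
    (P (Y n @^-1` `]-oo, (x - delta / 2)%R]) + (eta / 2)%:E)%E).
    by have [_ +] := Yn (x - delta / 2); rewrite -addrA -opprD -splitr.
  rewrite addeA leeD2r//.
  apply: (holds_up_to_le _ _ _ close); try exact: mpre.
  move=> w []/=; rewrite !in_itv/= ler_distl => Zx /andP[_ YZ]; lra.
Unshelve. all: by end_near. Qed.

Lemma cvg_levy_in_distribution d (Omega : measurableType d)
    (P : probability Omega R) (Y : nat -> Omega -> R) :
  (forall n, measurable_fun setT (Y n)) -> cvg_levy P Y ->
  cvg_in_distribution P Y mu.
Proof.
move=> mY Ymu; split=> // x Fx.
have fmu y : mu `]-oo, y]%classic = (fine (mu `]-oo, y]%classic))%:E.
  by rewrite fineK// fin_num_measure.
have fP n : P (Y n @^-1` `]-oo, x]%classic) =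
    (fine (P (Y n @^-1` `]-oo, x]%classic)))%:E.
  by rewrite fineK// fin_num_measure// -[_ @^-1` _]setTI; exact: mY.
rewrite (funext fP) fmu; apply: cvg_EFin; first by near=> n.
apply/cvgrPdist_le => eps eps0.
have /fine_cvg/= :
    mu `]-oo, y]%classic @[y --> x] --> (fine (mu `]-oo, x]%classic))%:E.
  by rewrite -fmu; exact: Fx.
move=> /cvgrPdist_le.
have eps2 : 0 < eps / 2 by rewrite divr_gt0.
move=> /(_ _ eps2) /nbhs_ballP[r /= r0 Fr].
have r2 : 0 < r / 2 by rewrite divr_gt0.
near=> n.
have [] : (P (Y n @^-1` `]-oo, x]%classic) <=
      mu `]-oo, (x + r / 2)%R]%classic + (eps / 2)%:E)%E /\
    (mu `]-oo, (x - r / 2)%R]%classic <=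
      P (Y n @^-1` `]-oo, x]%classic) + (eps / 2)%:E)%E.
  by move: (x); near: n; exact: Ymu.
rewrite (fmu (x + _)) (fmu (x - _)) fP -!EFinD !lee_fin.
have := Fr (x + r / 2); have := Fr (x - r / 2); rewrite /ball/=.
rewrite opprB addrC subrK opprD addrA subrr sub0r normrN gtr0_norm// gtr_pMr//.
rewrite invf_lt1// ltr1n => /(_ isT) + /(_ isT).
rewrite !ler_distl; lra.
Unshelve. all: by end_near. Qed.
End Levy.

(** * Transport between processes with the same law *)

Section Transport.
Context (R : realType) d (Omega : measurableType d) (P : probability Omega R)
  d' (Omega' : measurableType d') (P' : probability Omega' R).
Variables (e : nat -> {RV P >-> R}) (e' : nat -> {RV P' >-> R}).
Hypothesis ee' : same_law e e'.

Lemma measurable_window d1 (Omega1 : measurableType d1)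
    (P1 : probability Omega1 R) (e1 : nat -> {RV P1 >-> R}) k n :
  measurable_fun setT (window e1 k n).
Proof.
apply/measurable_fun_tnthP => i.
rewrite (_ : _ \o _ = e1 (k + i).+1).
  exact: (@measurable_funPT _ _ _ _ (e1 (k + i).+1)).
by apply/funext => w; rewrite /window /= tnth_mktuple.
Qed.

(** The exceptional set on the second space need not be an event about the
    process, so it is replaced by the event that [A] fails. *)
Lemma holds_up_to_transport n (A : set (n.-tuple (measurableTypeR R))) eta :
  measurable A -> holds_up_to P' (window e' 0 n @^-1` A) eta ->
  holds_up_to P (window e 0 n @^-1` A) eta.
Proof.
move=> mA [E [mE PE EA]].
have mAC : measurable (~` A) by exact: measurableC.
have mW d1 (O1 : measurableType d1) (P1 : probability O1 R)
    (e1 : nat -> {RV P1 >-> R}) : measurable (window e1 0 n @^-1` (~` A)).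
  by rewrite -[X in measurable X]setTI; exact: measurable_window.
exists (window e 0 n @^-1` (~` A)); split.
- exact: mW.
- rewrite ee'//; apply: le_trans PE; apply: le_measure; rewrite ?inE//.
  by move=> w; apply: contra_notP => /EA.
- by move=> w /=; exact: contrapT.
Qed.

Variable g : forall n, n.-tuple (measurableTypeR R) -> R.
Hypothesis mg : forall n, measurable_fun setT (@g n).

Lemma measurable_norm_le n M : measurable [set t | `|@g n t| <= M].
Proof.
rewrite (_ : mkset _ = @g n @^-1` `[- M, M]%classic); last first.
  by apply/seteqP; split => t /=; rewrite in_itv/= ler_norml.
by rewrite -[X in measurable X]setTI; exact: mg.
Qed.

Lemma vanishing_transport :
  vanishing_in_prob P' (fun n w => g (window e' 0 n w)) ->
  vanishing_in_prob P (fun n w => g (window e 0 n w)).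
Proof.
move=> g0 eps eta eps0 eta0; apply: filterS (g0 _ _ eps0 eta0) => n.
exact: (holds_up_to_transport (measurable_norm_le eps)).
Qed.

Lemma bounded_transport :
  bounded_in_prob P' (fun n w => g (window e' 0 n w)) ->
  bounded_in_prob P (fun n w => g (window e 0 n w)).
Proof.
move=> gb eta eta0; have [M M0 gM] := gb _ eta0; exists M => //.
apply: filterS gM => n; exact: (holds_up_to_transport (measurable_norm_le M)).
Qed.

Lemma eq_law_transport n (A : set R) : measurable A ->
  P ((fun w => g (window e 0 n w)) @^-1` A) =
  P' ((fun w => g (window e' 0 n w)) @^-1` A).
Proof.
move=> mA; apply: (@ee' n (@g n @^-1` A)).
by rewrite -[X in measurable X]setTI; exact: mg.
Qed.
End Transport.

(** * Summation by parts *)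

Section AbelSummation.
Context (R : realType).
Implicit Types (s D : nat -> R) (n : nat).

Lemma abel_summation s D n : D 0%N = 0 ->
  \sum_(1 <= i < n.+2) s i * (D i - D i.-1) =
  s n.+1 * D n.+1 - \sum_(2 <= i < n.+2) (s i - s i.-1) * D i.-1.
Proof.
move=> D0; elim: n => [|n IH].
  by rewrite big_nat1 big_geq// D0 !subr0.
rewrite big_nat_recr//= IH [in RHS]big_nat_recr//=; ring.
Qed.

(** Summation by parts moves the differences from [D] to the weights, whose
    total variation then multiplies the maximum of [D]. *)
Lemma abel_bound s D n : D 0%N = 0 ->
  `|\sum_(1 <= i < n.+1) s i * (D i - D i.-1)| <=
  array_variation s n * \big[Num.max/0]_(1 <= i < n.+1) `|D i|.
Proof.
move=> D0; case: n => [|n].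
  by rewrite !big_geq// normr0 mulr0.
set M := \big[Num.max/0]_(_ <= _ < _) _.
have DM i : (1 <= i <= n.+1)%N -> `|D i| <= M.
  move=> i1; apply: (@Order.TotalTheory.le_bigmax_seq _ R _ _ 0 i xpredT
    (fun i => `|D i|)) => //.
  by rewrite mem_index_iota.
rewrite abel_summation// /array_variation mulrDl mulr_suml.
apply: le_trans (ler_normB _ _) _; apply: lerD.
  by rewrite normrM ler_wpM2l// DM//=.
apply: le_trans (ler_norm_sum _ _ _) _; apply: ler_sum_nat => i /andP[i2 i3].
case: i i2 i3 => // i i2 i3; rewrite normrM ler_wpM2l// DM//=.
by rewrite -ltnS i2 ltnW.
Qed.
End AbelSummation.

(** * Weighted sums of Brownian increments *)

Section BrownianSums.
Context (R : realType) d (Omega : measurableType d) (P : probability Omega R).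
Variable (B : R -> {RV P >-> R}).
Hypothesis BM : standard_brownian_motion B.

Lemma measurable_increment s t : measurable_fun setT (increment B s t).
Proof. by apply: measurable_funB; apply: measurable_funPT. Qed.

Lemma brownian_weighted_sum_law n (s : nat -> R) (A : set R) :
  0 < \sum_(1 <= i < n.+1) s i ^+ 2 -> measurable A ->
  P [set w | A (\sum_(1 <= i < n.+1) s i * (B i%:R w - B i.-1%:R w))] =
  normal_prob 0 (Num.sqrt (\sum_(1 <= i < n.+1) s i ^+ 2)) A.
Proof.
have [_ _ B_law B_indep] := BM.
rewrite big_add1 big_mkord => s0 mA.
have := @gaussian_sum_law _ _ _ P (fun i => increment B i%:R i.+1%:R) n _ _ _
  (fun i => s i.+1) A s0 mA.
move=> <-.
- congr (P _); apply/seteqP; split => w /=; by rewrite big_add1 big_mkord.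
- by move=> i; exact: measurable_increment.
- move=> i _ C mC; rewrite B_law//; last by rewrite ltr_nat.
  by rewrite -natrB// subSnn sqrtr1.
- move=> C mC; rewrite (B_indep n (fun i => i%:R))//.
  by move=> i _; rewrite ltr_nat.
Qed.
End BrownianSums.

(** * Weighted sums under a strong invariance principle *)

Section StrongInvariance.
Context (R : realType).

(** A single law is tight, since the complements of the intervals
    [ [-k, k] ] decrease to the empty set. *)
Lemma bounded_eq_law d (Omega : measurableType d) (P : probability Omega R)
    (Y : nat -> Omega -> R) (mu : probability (measurableTypeR R) R) :
  (forall n, measurable_fun setT (Y n)) ->
  (\forall n \near \oo, forall A, measurable A -> P (Y n @^-1` A) = mu A) ->
  bounded_in_prob P Y.
Proof.
move=> mY Ymu eta eta0.
pose F k := ~` `[- k%:R : R, k%:R]%classic.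
have mF k : measurable (F k) by apply: measurableC.
have : mu (F k) @[k --> \oo] --> mu (\bigcap_k F k).
  apply: nonincreasing_cvg_mu => //.
  - apply: (le_lt_trans _ (ltry 1)); exact: (probability_le1 mu (mF 0%N)).
  - by apply: bigcap_measurableType => k _; exact: mF.
  - move=> j k jk; apply/subsetPset/subsetC.
    apply: subset_itv; rewrite bnd_simp.
      by rewrite lerN2 ler_nat.
    by rewrite ler_nat.
have -> : \bigcap_k F k = set0.
  rewrite -subset0 => x /(_ (Num.bound `|x|) I); apply => /=.
  by rewrite in_itv/= -ler_norml ltW// archi_boundP.
rewrite measure0 => /fine_cvgP[_ /cvgr0Pnorm_le /(_ _ eta0)] [k _ Fk].
exists k.+1%:R => //; apply: filterS Ymu => n Yn.
exists (Y n @^-1` F k.+1); split.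
- by rewrite -[_ @^-1` _]setTI; exact: mY.
- have fk : mu (F k.+1) \is a fin_num by apply: fin_num_measure; exact: mF.
  rewrite Yn// -[mu _]fineK// lee_fin.
  by apply: le_trans (Fk k.+1 _); [exact: ler_norm|exact: leqnSn].
- by move=> w /= /contrapT; rewrite /= in_itv/= -ler_norml.
Qed.

Lemma rate_gt0 n : (2 <= n)%N -> 0 < rate n :> R.
Proof.
move=> n2; rewrite /rate mulr_gt0 ?powR_gt0 ?ltr0n ?ln_gt0 ?ltr1n//.
exact: leq_trans n2.
Qed.

(** [G n] is the weighted sum of Brownian increments divided by its standard
    deviation, hence exactly normal.  The normalization [a] is left free: for
    the noise it is the standard deviation itself, for the squares of the noise
    it is of larger order, which makes the Gaussian term negligible. *)
Lemma sip_weighted_sum d (Omega : measurableType d) (P : probability Omega R)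
    (e : nat -> {RV P >-> R}) (f : R -> R) (tau : R)
    (s : nat -> nat -> R) (a : nat -> R) :
  measurable_fun setT f -> strong_invariance e f tau rate ->
  (\forall n \near \oo, 0 < Sigma_sq (s n) n) ->
  (\forall n \near \oo, 0 < a n) ->
  (array_variation (s n) n * rate n / a n) @[n --> \oo] --> 0 ->
  exists (d' : measure_display) (Omega' : measurableType d')
    (P' : probability Omega' R) (e' : nat -> {RV P' >-> R})
    (G : nat -> Omega' -> R),
  [/\ same_law e e', forall n, measurable_fun setT (G n),
     (forall c, c != 0 -> \forall n \near \oo, forall A, measurable A ->
        P' ((fun w => c * G n w) @^-1` A) = normal_prob 0 c A) &
     vanishing_in_prob P' (fun n w =>
       (\sum_(1 <= i < n.+1) s n i * f (e' i w)) / a n -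
       Sigma (s n) n / a n * (tau * G n w))].
Proof.
move=> mf [d' [ Omega' [P' [e' [B [ee' BM approx]]]]]] s0 a0 Va.
pose W n w := \sum_(1 <= i < n.+1) s n i * (B i%:R w - B i.-1%:R w).
exists d', Omega', P', e', (fun n w => W n w / Sigma (s n) n).
have mW n : measurable_fun setT (W n).
  apply: measurable_sum => i; apply: measurable_funM => //.
  by apply: measurable_funB; apply: measurable_funPT.
split=> //.
- by move=> n; apply: measurable_funM.
- move=> c c0; apply: filterS s0 => n Sn A mA.
  have Sn0 : 0 < Sigma (s n) n by rewrite sqrtr_gt0.
  pose b i := c / Sigma (s n) n * s n i.
  have bE : \sum_(1 <= i < n.+1) b i ^+ 2 = c ^+ 2.
    under eq_bigr do rewrite exprMn.
    rewrite -mulr_sumr -/(Sigma_sq (s n) n) expr_div_n sqr_sqrtr ?ltW//.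
    by rewrite divfK// gt_eqF.
  have := @brownian_weighted_sum_law _ _ _ _ B BM n b A.
  rewrite bE sqrtr_sqr exprn_even_gt0//= => /(_ c0 mA).
  rewrite normal_prob_abs => <-; congr (P' _); apply/seteqP.
  have E w : \sum_(1 <= i < n.+1) b i * (B i%:R w - B i.-1%:R w) =
      c * (W n w / Sigma (s n) n).
    under eq_bigr do rewrite -mulrA.
    by rewrite -mulr_sumr -mulrA; congr (_ * _); rewrite mulrC.
  by split=> w /=; rewrite E.
have [B0 _ _ _] := BM.
(* [B 0 w] is only almost surely zero; subtracting it makes [D] vanish at 0
   everywhere, as summation by parts requires. *)
pose D i w := \sum_(1 <= j < i.+1) f (e' j w) - tau * (B i%:R w - B 0 w).
pose M n w := (\big[Num.max/0]_(1 <= i < n.+1) `|D i w|) / rate n.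
have mD i : measurable_fun setT (D i).
  apply: measurable_funB; last first.
    by apply: measurable_funM => //; exact: measurable_increment.
  apply: measurable_sum => j; apply: measurableT_comp => //.
have mM n : measurable_fun setT (M n).
  apply: measurable_funM => //.
  elim: (index_iota 1 n.+1) => [|i r IH].
    rewrite (_ : (fun _ => _) = cst 0)//.
    by apply/funext => w; rewrite big_nil.
  rewrite (_ : (fun _ => _) = fun w =>
     Num.max `|D i w| (\big[Num.max/0]_(j <- r) `|D j w|)).
    by apply: measurable_maxr => //; exact: measurableT_comp.
  by apply/funext => w; rewrite big_cons.
have M0 : vanishing_in_prob P' M.
  apply: vanishing_ae => //; apply: filterS2 B0 approx => w B0w.
  have -> : M ^~ w = fun n => (\big[Num.max/0]_(1 <= i < n.+1)
      `|\sum_(1 <= j < i.+1) f (e' j w) - tau * B i%:R w|) / rate n.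
    apply/funext => n; congr (_ / _).
    by apply: eq_bigr => i _; rewrite /D B0w subr0.
  exact.
have M1 := vanishing_bounded M0.
apply: le_vanishing (vanishingM (vanishing_cst P' Va) M1).
near=> n => w.
have an : 0 < a n by near: n.
have rn : 0 < rate n :> R by apply: rate_gt0; near: n; exact: nbhs_infty_ge.
have Sn : 0 < Sigma (s n) n by rewrite sqrtr_gt0; near: n.
rewrite [X in `|X| <= _](_ : _ =
    (\sum_(1 <= i < n.+1) s n i * (D i w - D i.-1 w)) / a n); last first.
  have -> : Sigma (s n) n / a n * (tau * (W n w / Sigma (s n) n)) =
      tau * W n w / a n by field; rewrite !gt_eqF.
  rewrite -mulrBl /W mulr_sumr -sumrB; congr (_ / _).
  apply: eq_big_nat => -[//|i] _; rewrite /D [in RHS]big_nat_recr//=; ring.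
have V0 : 0 <= array_variation (s n) n by rewrite addr_ge0// sumr_ge0.
have max0 : 0 <= \big[Num.max/0]_(1 <= i < n.+1) `|D i w|.
  exact: bigmax_ge_id.
rewrite normrM [`|(a n)^-1|]gtr0_norm ?invr_gt0//.
rewrite [leRHS]ger0_norm; last first.
  have a_ge0 := ltW an; have r_ge0 := ltW rn.
  by apply: mulr_ge0; apply: divr_ge0 => //; apply: mulr_ge0.
rewrite /M (_ : _ * _ = array_variation (s n) n *
   (\big[Num.max/0]_(1 <= i < n.+1) `|D i w|) / a n); last first.
  by field; rewrite !gt_eqF.
rewrite ler_pM2r ?invr_gt0//; apply: (@abel_bound _ (s n) (fun i => D i w)).
by rewrite /D big_geq// subrr mulr0 subr0.
Unshelve. all: by end_near. Qed.
End StrongInvariance.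

(** * Sums of squares of weighted arrays *)

Section Weights.
Context (R : realType).
Implicit Types (n i : nat) (s sigma c : nat -> R).

Lemma sum_nat_id n : \sum_(1 <= i < n.+1) i%:R = n%:R * (n%:R + 1) / 2 :> R.
Proof.
elim: n => [|n IH]; first by rewrite big_geq// mul0r mul0r.
by rewrite big_nat_recr//= IH; field.
Qed.

Lemma sum_nat_sqr n :
  \sum_(1 <= i < n.+1) i%:R ^+ 2 = n%:R * (n%:R + 1) * (2 * n%:R + 1) / 6 :> R.
Proof.
elim: n => [|n IH]; first by rewrite big_geq// !mul0r.
by rewrite big_nat_recr//= IH; field.
Qed.

(** As long as the count is positive, [n] lies above [lo]; the count is then at
    most [n - lo + 1], and it stops growing when [n] reaches [hi]. *)
Lemma count_nat_between (lo hi : R) n : lo <= hi ->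
  \sum_(1 <= i < n.+1 | lo < i%:R < hi) 1 <= hi - lo + 1 :> R.
Proof.
move=> lohi; set t := fun n => \sum_(1 <= i < n.+1 | lo < i%:R < hi) 1 : R.
suff : t n = 0 \/ t n <= n%:R - lo + 1 /\ t n <= hi - lo + 1.
  rewrite /t => -[->|[]//]; lra.
elim: n => [|n IH]; first by left; rewrite /t big_geq.
have -> : t n.+1 = t n + (if lo < n.+1%:R < hi then 1 else 0).
  by rewrite /t big_mkcond big_nat_recr//= -big_mkcond.
have -> : n.+1%:R = n%:R + 1 :> R by rewrite -addn1 natrD.
case: ifPn => [/andP[lon nhi]|_]; first by right; case: IH => [->|[]]; lra.
by rewrite addr0; case: IH => [->|[]]; [left|right; lra].
Qed.

Lemma Sigma_sq_gt0 (s : nat -> R) n i :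
  (1 <= i <= n)%N -> s i != 0 -> 0 < Sigma_sq s n.
Proof.
move=> i1n si; rewrite /Sigma_sq lt_def.
rewrite psumr_neq0 => [|j _]; last exact: sqr_ge0.
rewrite sumr_ge0 ?andbT => [|j _]; last exact: sqr_ge0.
apply/hasP; exists i; first by rewrite mem_index_iota.
by rewrite /= exprn_even_gt0.
Qed.

Lemma Sigma_sq_ge0 s n : 0 <= Sigma_sq s n.
Proof. by apply: sumr_ge0 => i _; exact: sqr_ge0. Qed.

Lemma ler_sqr_norm (x y : R) : `|x| <= y -> x ^+ 2 <= y ^+ 2.
Proof.
move=> xy; rewrite -[x ^+ 2]real_normK ?num_real// lerXn2r ?nnegrE//.
exact: le_trans xy.
Qed.

(** Telescoping from the last entry of the array. *)
Lemma le_array_variation s n i : (1 <= i <= n)%N ->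
  `|s i| <= array_variation s n.
Proof.
elim: n => [|n IH]; first by case: i.
case/andP => i1; rewrite leq_eqVlt => /predU1P[->|in1].
  by rewrite /array_variation lerDl sumr_ge0.
have n1 : (1 <= n)%N by rewrite (leq_trans i1).
apply: le_trans (IH _) _; first by rewrite i1.
rewrite /array_variation [in leRHS]big_nat_recr//= addrCA [leLHS]addrC lerD2l.
rewrite -{1}[s n](subKr (s n.+1)); exact: ler_normB.
Qed.

(** Cut the sum at [|c' i| = K].  Since [c'] is affine with slope at least 2,
    at most [K + 1] indices have [|c' i| < K], and each contributes at most
    the squared variation.  At the other indices [|c i| <= 2 n], so [c i ^+ 2]
    is at most [4 n ^+ 2 / K ^+ 2] times [c' i ^+ 2]. *)
Lemma Sigma_sq_le sigma (a b K : R) c c' n : 2 <= a -> 0 < K ->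
  (forall i, (1 <= i <= n)%N -> `|c i| <= 2 * n%:R) ->
  (forall i, (1 <= i <= n)%N -> `|c' i| = `|a * i%:R - b|) ->
  Sigma_sq (fun i => c i * sigma i) n <=
  (K + 1) * array_variation (fun i => c i * sigma i) n ^+ 2 +
  4 * n%:R ^+ 2 / K ^+ 2 * Sigma_sq (fun i => c' i * sigma i) n.
Proof.
move=> a2 K0 cb c'E; set s := fun i => c i * sigma i.
set s' := fun i => c' i * sigma i.
have C0 : 0 <= 4 * n%:R ^+ 2 / K ^+ 2.
  by apply: divr_ge0; [apply: mulr_ge0 => //; exact: sqr_ge0|exact: sqr_ge0].
pose near i := (b - K) / a < i%:R < (b + K) / a.
apply: (@le_trans _ _ (\sum_(1 <= i < n.+1)
  ((if near i then 1 else 0) * array_variation s n ^+ 2 +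
   4 * n%:R ^+ 2 / K ^+ 2 * s' i ^+ 2))).
  apply: ler_sum_nat => i /andP[i1 i2].
  have i12 : (1 <= i <= n)%N by rewrite i1.
  case: ifPn => [_|far].
    rewrite mul1r; apply: (@le_trans _ _ (array_variation s n ^+ 2)).
      exact/ler_sqr_norm/le_array_variation.
    by rewrite lerDl; apply: mulr_ge0 => //; exact: sqr_ge0.
  rewrite mul0r add0r.
  have K1 : K <= `|c' i|.
    rewrite c'E//; move: far.
    rewrite negb_and -!leNgt ler_pdivlMr ?ler_pdivrMr; try lra.
    rewrite ler_normr => /orP[h|h]; apply/orP; [right|left]; lra.
  rewrite /s /s' /= !exprMn [leRHS]mulrA.
  apply: ler_wpM2r; first exact: sqr_ge0.
  have c2 : c i ^+ 2 <= 4 * n%:R ^+ 2.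
    rewrite (_ : 4 * _ = (2 * n%:R) ^+ 2); last by ring.
    by apply: ler_sqr_norm; exact: cb.
  apply: le_trans c2 _; rewrite -mulrA ler_peMr ?mulr_ge0 ?sqr_ge0//.
  rewrite mulrC ler_pdivlMr ?exprn_gt0// mul1r.
  by rewrite -[leRHS]real_normK ?num_real// lerXn2r ?nnegrE ?(ltW K0).
rewrite big_split/= -mulr_suml -mulr_sumr lerD2r ler_wpM2r ?sqr_ge0//.
rewrite -big_mkcond; apply: le_trans (count_nat_between _ _) _.
  by rewrite ler_pM2r ?invr_gt0; lra.
rewrite lerD2r -mulrBl ler_pdivrMr; last by lra.
have : K * 2 <= K * a by rewrite ler_pM2l.
lra.
Qed.

Lemma intercept_weight_bound n i : (1 <= i <= n)%N ->
  `|intercept_weight n i : R| <= 2 * n%:R.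
Proof.
rewrite -!(ler_nat R) => /andP[i1 i2].
by rewrite /intercept_weight ler_norml; apply/andP; split; lra.
Qed.

Lemma slope_weight_bound n i : (1 <= i <= n)%N ->
  `|slope_weight n i : R| <= 2 * n%:R.
Proof.
rewrite -!(ler_nat R) => /andP[i1 i2].
by rewrite /slope_weight ler_norml; apply/andP; split; lra.
Qed.

Lemma intercept_weight_affine n i :
  `|intercept_weight n i : R| = `|3 * i%:R - (2 * n%:R + 1)|.
Proof. by rewrite -normrN; congr `|_|; rewrite /intercept_weight; ring. Qed.

Lemma slope_weight_affine n i :
  `|slope_weight n i : R| = `|2 * i%:R - (n%:R + 1)|.
Proof. by congr `|_|; rewrite /slope_weight; ring. Qed.
End Weights.

(** * Comparison of the two arrays and least squares formulas *)

Section Regression.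
Context (R : realType).
Implicit Types (n i : nat) (sigma : nat -> nat -> R).

Lemma cvg_ln_natr : (ln n%:R : R) @[n --> \oo] --> +oo.
Proof.
apply/cvgryPge => A; near=> n.
have An : expR A <= n%:R by near: n; exact: nbhs_infty_ger.
rewrite -[A]expRK ler_ln ?posrE ?expR_gt0//.
exact: lt_le_trans (expR_gt0 A) An.
Unshelve. all: by end_near. Qed.

Lemma rate_expr4 n : (rate n : R) ^+ 4 = n%:R * ln n%:R ^+ 4.
Proof.
have n4 : ((n%:R : R) `^ 4^-1) ^+ 4 = n%:R.
  by rewrite -powR_mulrn ?powR_ge0// -powRrM mulVf// powRr1.
by rewrite /rate exprMn n4.
Qed.

(** [Sigma_sq_le] with [K = rate n ^+ 2]: the squared variation of [s] is
    [o (Sigma_sq / rate n ^+ 2)], so the first term is absorbed by the left-hand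
    side, and the second one carries the factor
    [n ^+ 2 / K ^+ 2 = n / ln n ^+ 4], which is [o(n)].  The logarithm in [rate]
    is thus exactly what makes the ratio vanish. *)
Lemma Sigma_sq_ratio sigma (c c' : nat -> nat -> R) (a : R) (b : nat -> R) :
  2 <= a -> (forall n i, (1 <= i <= n)%N -> `|c n i| <= 2 * n%:R) ->
  (forall n i, (1 <= i <= n)%N -> `|c' n i| = `|a * i%:R - b n|) ->
  let s n i := c n i * sigma n i in let s' n i := c' n i * sigma n i in
  (\forall n \near \oo, 0 < Sigma_sq (s n) n) ->
  (\forall n \near \oo, 0 < Sigma_sq (s' n) n) ->
  array_variation (s n) n * rate n / Sigma (s n) n @[n --> \oo] --> 0 ->
  Sigma_sq (s n) n / (n%:R * Sigma_sq (s' n) n) @[n --> \oo] --> 0.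
Proof.
move=> a2 cb c'E s s' s0 s'0 /cvgr0Pnorm_le V0.
apply: (@squeeze_cvgr _ _ _ _ (cst 0) (fun n => 8 * (ln n%:R)^-1)); last first.
- rewrite -[0 in X in _ --> X](mulr0 8); apply: cvgMr.
  apply/gtr0_cvgV0; last exact: cvg_ln_natr.
  by near=> n; rewrite ln_gt0// ltr1n; near: n; exact: nbhs_infty_ge.
- exact: cvg_cst.
near=> n.
have n2 : (2 <= n)%N by near: n; exact: nbhs_infty_ge.
have n0 : 0 < n%:R :> R by rewrite ltr0n ltnW.
have ln1 : 1 <= ln n%:R :> R.
  by near: n; move/cvgryPge : cvg_ln_natr; apply.
have sn : 0 < Sigma_sq (s n) n by near: n.
have s'n : 0 < Sigma_sq (s' n) n by near: n.
have Sn : 0 < Sigma (s n) n by rewrite sqrtr_gt0.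
have r0 : 0 < rate n :> R by exact: rate_gt0.
have r1 : 1 <= (rate n : R) ^+ 2.
  rewrite exprn_ege1// /rate mulr_ege1//.
  apply: (@le_trans _ _ (1 `^ 4^-1)); first by rewrite powR1.
  rewrite ge0_ler_powR ?nnegrE ?invr_ge0//.
  by rewrite ler1n ltnW.
have Vn : array_variation (s n) n * rate n / Sigma (s n) n <= 2^-1.
  by apply: le_trans (ler_norm _) _; near: n; apply: V0; rewrite invr_gt0.
have V0n : 0 <= array_variation (s n) n by rewrite addr_ge0// sumr_ge0.
have V2 : array_variation (s n) n ^+ 2 * rate n ^+ 2 <= Sigma_sq (s n) n / 4.
  move: Vn; rewrite ler_pdivrMr// => Vn.
  rewrite -exprMn -[Sigma_sq _ _]sqr_sqrtr ?Sigma_sq_ge0// -/(Sigma _ _).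
  rewrite (_ : _ / 4 = (2^-1 * Sigma (s n) n) ^+ 2); last by field.
  have S_ge0 := ltW Sn; have r_ge0 := ltW r0.
  by rewrite lerXn2r ?nnegrE//; apply: mulr_ge0 => //; rewrite invr_ge0.
apply/andP; split.
  by apply: divr_ge0; [exact: ltW|apply: mulr_ge0; exact: ltW].
rewrite ler_pdivrMr ?mulr_gt0//.
have := Sigma_sq_le (sigma n) a2 (exprn_gt0 2 r0) (cb n) (c'E n).
rewrite -/(s n) -/(s' n) -exprM (rate_expr4 n).
have ln0 : 0 < ln n%:R :> R by exact: lt_le_trans ln1.
set C := 4 * _ / _; set V := array_variation _ _ in V2 *.
set r := rate n ^+ 2 in r1 V2 *.
move=> key.
have CE : C <= 4 * n%:R / ln n%:R.
  rewrite /C (_ : _ / _ = 4 * n%:R / ln n%:R ^+ 4); last first.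
    by field; rewrite !gt_eqF.
  rewrite ler_pM2l ?mulr_gt0// lef_pV2 ?posrE ?exprn_gt0//.
  by rewrite -[leLHS]expr1 ler_weXn2l.
have VV : (r + 1) * V ^+ 2 <= 2 * (V ^+ 2 * r).
  rewrite mulrC mulrDr mulr1.
  rewrite [leRHS](_ : _ = V ^+ 2 * r + V ^+ 2 * r); last by ring.
  by rewrite lerD2l ler_peMr ?sqr_ge0.
have CS : C * Sigma_sq (s' n) n <= 4 * n%:R / ln n%:R * Sigma_sq (s' n) n.
  by rewrite ler_pM2r.
rewrite [leRHS](_ : _ = 2 * (4 * n%:R / ln n%:R * Sigma_sq (s' n) n));
  last by ring.
lra.
Unshelve. all: by end_near. Qed.

Lemma cvg_inv_natr : (n%:R^-1 : R) @[n --> \oo] --> 0.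
Proof.
apply/gtr0_cvgV0; last exact: cvgr_idn.
by near=> n; rewrite ltr0n; near: n; exact: nbhs_infty_gt.
Unshelve. all: by end_near. Qed.

Lemma Sigma_sq_self_ratio (s : nat -> nat -> R) :
  (\forall n \near \oo, 0 < Sigma_sq (s n) n) ->
  Sigma_sq (s n) n / (n%:R * Sigma_sq (s n) n) @[n --> \oo] --> (0 : R).
Proof.
move=> s0; apply: cvg_trans cvg_inv_natr; apply: near_eq_cvg.
by apply: filterS s0 => n sn; rewrite invfM mulrCA divff ?gt_eqF// mulr1.
Qed.

Lemma regression_estimates (beta0 beta1 : R) (sigma : nat -> nat -> R)
    (Omega : Type) (e : nat -> Omega -> R) n w : (2 <= n)%N ->
  let X := regression_model beta0 beta1 sigma e n w in
  intercept_estimate X n - beta0 = 2 / (n%:R * (n%:R - 1)) *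
    \sum_(1 <= i < n.+1) intercept_weight n i * sigma n i * e i w /\
  slope_estimate X n - beta1 = 6 / (n%:R ^+ 2 - 1) *
    \sum_(1 <= i < n.+1) slope_weight n i * sigma n i * e i w.
Proof.
move=> n2 X.
have n0 : n%:R != 0 :> R by rewrite pnatr_eq0 -lt0n ltnW.
have n1 : n%:R - 1 != 0 :> R by rewrite subr_eq0 pnatr_eq1 gtn_eqF.
have n1' : n%:R + 1 != 0 :> R by rewrite natr1 pnatr_eq0.
have n3 : n%:R ^+ 2 - 1 != 0 :> R.
  by rewrite (_ : _ - 1 = (n%:R - 1) * (n%:R + 1)) ?mulf_neq0//; ring.
pose A := \sum_(1 <= i < n.+1) sigma n i * e i w.
pose B := \sum_(1 <= i < n.+1) i%:R * (sigma n i * e i w).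
have XA : \sum_(1 <= i < n.+1) X i =
    n%:R * beta0 + beta1 * ((n%:R + 1) / 2) + A.
  rewrite /X /regression_model !big_split/= -/A -mulr_sumr -mulr_suml.
  rewrite sum_nat_id.
  rewrite sumr_const_nat subSS subn0 -mulr_natl; congr (_ + _).
  by field.
have XB : \sum_(1 <= i < n.+1) i%:R * X i = beta0 * (n%:R * (n%:R + 1) / 2) +
    beta1 * ((n%:R + 1) * (2 * n%:R + 1) / 6) + B.
  rewrite /X /regression_model (eq_bigr (fun i => beta0 * i%:R +
    beta1 / n%:R * i%:R ^+ 2 + i%:R * (sigma n i * e i w))); last first.
    by move=> i _; field.
  rewrite !big_split/= -/B -!mulr_sumr sum_nat_id sum_nat_sqr; congr (_ + _).
  by field.
have CB : \sum_(1 <= i < n.+1) slope_weight n i * sigma n i * e i w =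
    2 * B - (n%:R + 1) * A.
  rewrite /A /B !mulr_sumr -sumrB; apply: eq_bigr => i _.
  by rewrite /slope_weight; ring.
have CA : \sum_(1 <= i < n.+1) intercept_weight n i * sigma n i * e i w =
    (2 * n%:R + 1) * A - 3 * B.
  rewrite /A /B !mulr_sumr -sumrB; apply: eq_bigr => i _.
  by rewrite /intercept_weight; ring.
have den :
    \sum_(1 <= i < n.+1) i%:R ^+ 2 - (\sum_(1 <= i < n.+1) i%:R) ^+ 2 / n%:R =
    n%:R * (n%:R - 1) * (n%:R + 1) / 12 :> R.
  by rewrite sum_nat_sqr sum_nat_id; field.
have slopeE : slope_estimate X n =
    beta1 + 6 / (n%:R ^+ 2 - 1) * (2 * B - (n%:R + 1) * A).
  rewrite /slope_estimate den XA XB sum_nat_id; field.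
  by rewrite n0 n1 n1' n3.
split; last by rewrite slopeE CB addrC addKr.
rewrite /intercept_estimate slopeE /sample_mean XA CA -[n.+1%:R]natr1.
by field; rewrite n0 n1 n3.
Qed.
End Regression.

(** * Limits of weighted sums on the original space *)

Section WeightedSums.
Context (R : realType).

Lemma nth_window d (Omega : measurableType d) (P : probability Omega R)
    (e : nat -> {RV P >-> R}) n i w : (1 <= i <= n)%N ->
  nth 0 (window e 0 n w) i.-1 = e i w.
Proof.
case: i => // i /andP[_ lt_in].
by rewrite -(tnth_nth 0 _ (Ordinal lt_in)) tnth_mktuple add0n.
Qed.

Lemma measurable_tuple_nth n j :
  measurable_fun setT (fun t : n.-tuple (measurableTypeR R) => nth (0 : R) t j).
Proof.
have [jn|nj] := ltnP j n; last first.
  rewrite (_ : (fun _ => _) = cst 0)//; apply/funext => t.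
  by rewrite nth_default// size_tuple.
rewrite (_ : (fun _ => _) = fun t => tnth t (Ordinal jn)).
  exact: measurable_tnth.
by apply/funext => t; rewrite (tnth_nth 0).
Qed.

(** The weighted sum as a function of the vector of the first [n] terms of the
    process, the form needed to compare laws; the term of index [i] is the
    entry [i.-1] of the vector. *)
Definition tuple_sum (f : R -> R) (s : nat -> nat -> R) (a : nat -> R) n
    (t : n.-tuple (measurableTypeR R)) : R :=
  (\sum_(1 <= i < n.+1) s n i * f (nth 0 t i.-1)) / a n.

Lemma measurable_tuple_sum f s a n : measurable_fun setT f ->
  measurable_fun setT (@tuple_sum f s a n).
Proof.
move=> mf; apply: measurable_funM => //; apply: measurable_sum => i.
apply: measurable_funM => //; apply: (measurableT_comp mf).
exact: measurable_tuple_nth.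
Qed.

Lemma tuple_sum_window d (Omega : measurableType d) (P : probability Omega R)
    (e : nat -> {RV P >-> R}) f s a :
  (fun n w => @tuple_sum f s a n (window e 0 n w)) =
  fun n w => (\sum_(1 <= i < n.+1) s n i * f (e i w)) / a n.
Proof.
apply/funext => n; apply/funext => w; congr (_ / _).
by apply: eq_big_nat => i in1; rewrite nth_window.
Qed.

Context d (Omega : measurableType d) (P : probability Omega R).
Variables (e : nat -> {RV P >-> R}) (f : R -> R) (s : nat -> nat -> R).
Hypothesis mf : measurable_fun setT f.
Hypothesis s_gt0 : \forall n \near \oo, 0 < Sigma_sq (s n) n.

(** Normalized by more than its standard deviation, the Gaussian approximation
    vanishes as well. *)
Lemma weighted_sum_vanishing (tau : R) (a : nat -> R) :
  strong_invariance e f tau rate -> (\forall n \near \oo, 0 < a n) ->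
  array_variation (s n) n * rate n / a n @[n --> \oo] --> 0 ->
  Sigma (s n) n / a n @[n --> \oo] --> 0 ->
  vanishing_in_prob P
    (fun n w => (\sum_(1 <= i < n.+1) s n i * f (e i w)) / a n).
Proof.
move=> sip a0 Va Sa.
have [d' [ Omega' [P' [e' [G [ee' mG G_law approx]]]]]] :=
  sip_weighted_sum mf sip s_gt0 a0 Va.
have Gb : bounded_in_prob P' G.
  apply: (bounded_eq_law (mu := normal_prob 0 1)) => //.
  apply: filterS (G_law 1 (oner_neq0 _)) => n Gn A mA; apply: etrans (Gn A mA).
  by congr (P' _); apply/seteqP; split => w /=; rewrite mul1r.
rewrite -(tuple_sum_window e f s a).
apply: (vanishing_transport ee') => [n|].
  exact: measurable_tuple_sum.
rewrite (tuple_sum_window e' f s a).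
have aG : vanishing_in_prob P' (fun n w => Sigma (s n) n / a n * tau * G n w).
  apply: (vanishingM _ Gb); apply: vanishing_cst.
  by rewrite -[0 in X in _ --> X](mul0r tau); apply: cvgMl.
apply: le_vanishing (vanishingD approx aG); near=> n => w.
by rewrite -[Sigma _ _ / a n * tau * _]mulrA subrK.
Unshelve. all: by end_near. Qed.

Lemma weighted_sum_normal (tau : R) : 0 < tau ->
  strong_invariance e f tau rate ->
  array_variation (s n) n * rate n / Sigma (s n) n @[n --> \oo] --> 0 ->
  let U n w := (\sum_(1 <= i < n.+1) s n i * f (e i w)) / Sigma (s n) n in
  cvg_levy (normal_prob 0 tau) P U /\ bounded_in_prob P U.
Proof.
move=> tau0 sip Va U.
have S0 : \forall n \near \oo, 0 < Sigma (s n) n.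
  by apply: filterS s_gt0 => n; rewrite sqrtr_gt0.
have [d' [ Omega' [P' [e' [G [ee' mG G_law approx]]]]]] :=
  sip_weighted_sum mf sip s_gt0 S0 Va.
have tauN : tau != 0 by rewrite gt_eqF.
pose U' n w := (\sum_(1 <= i < n.+1) s n i * f (e' i w)) / Sigma (s n) n.
have mtG n : measurable_fun setT (fun w => tau * G n w).
  exact: measurable_funM.
have mt n : measurable_fun setT
    (@tuple_sum f s (fun n => Sigma (s n) n) n) by exact: measurable_tuple_sum.
pose g n := @tuple_sum f s (fun n => Sigma (s n) n) n.
have UE : (fun n w => g n (window e 0 n w)) = U := tuple_sum_window e f s _.
have U'E : (fun n w => g n (window e' 0 n w)) = U' := tuple_sum_window e' f s _.
have mU' n : measurable_fun setT (U' n).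
  rewrite -U'E; apply: (measurableT_comp (mt n)); exact: measurable_window.
have UtG : vanishing_in_prob P' (fun n w => U' n w - tau * G n w).
  apply: le_vanishing approx; apply: filterS S0 => n Sn w.
  by rewrite divff ?gt_eqF// mul1r.
have lawG : \forall n \near \oo, forall A, measurable A ->
    P' ((fun w => tau * G n w) @^-1` A) = normal_prob 0 tau A by exact: G_law.
have tGb : bounded_in_prob P' (fun n w => tau * G n w).
  exact: (bounded_eq_law (mu := normal_prob 0 tau)).
split.
  have : cvg_levy (normal_prob 0 tau) P' U'.
    apply: (cvg_levy_vanishing mtG mU' UtG); exact: cvg_levy_law.
  apply: cvg_levy_eq_law => n A mA.
  rewrite -UE -U'E; exact: (eq_law_transport ee' mt).
rewrite -UE; apply: (bounded_transport ee') => //; rewrite U'E.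
have := boundedD_vanishing tGb UtG.
congr bounded_in_prob; apply/funext => n; apply/funext => w.
by rewrite addrC subrK.
Qed.
End WeightedSums.

(** * Residuals and studentization *)

Section Residuals.
Context (R : realType) d (Omega : measurableType d) (P : probability Omega R).

(** A sequence that is at most [theta] times a bounded one up to a vanishing
    term, for every [theta], vanishes: [theta] is chosen after the bound. *)
Lemma vanishing_relative (Y Z : nat -> Omega -> R) : bounded_in_prob P Y ->
  (forall theta, 0 < theta -> exists2 V, vanishing_in_prob P V &
     \forall n \near \oo, forall w,
       `|Z n w| <= theta * `|Y n w| + `|V n w|) ->
  vanishing_in_prob P Z.
Proof.
move=> Yb ZV eps eta eps0 eta0.
have eps2 : 0 < eps / 2 by rewrite divr_gt0.
have eta2 : 0 < eta / 2 by rewrite divr_gt0.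
have [M M0 YM] := Yb _ eta2.
have [V V0 ZYV] := ZV _ (divr_gt0 eps2 M0).
near=> n; rewrite [eta]splitr.
have YE : holds_up_to P [set w | `|Y n w| <= M] (eta / 2) by near: n.
have VE : holds_up_to P [set w | `|V n w| <= eps / 2] (eta / 2).
  by near: n; exact: V0.
apply: holds_up_toS (holds_up_toI YE VE) => w [/= Yw Vw].
apply: (@le_trans _ _ (eps / 2 / M * `|Y n w| + `|V n w|)).
  by move: w {Yw Vw}; near: n.
rewrite [leRHS]splitr lerD//.
by rewrite -[leRHS](divfK (lt0r_neq0 M0)) ler_wpM2l// divr_ge0// ltW.
Unshelve. all: by end_near. Qed.

(** Slutsky: [kappa n / sqrt W] tends to 1 in probability and [U] is tight. *)
Lemma studentized_vanishing (kappa : nat -> R) (U W : nat -> Omega -> R) :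
  kappa n @[n --> \oo] --> (1 : R) -> bounded_in_prob P U ->
  vanishing_in_prob P (fun n w => W n w - 1) ->
  vanishing_in_prob P (fun n w => kappa n * U n w / Num.sqrt (W n w) - U n w).
Proof.
move=> /cvgrPdist_le k1 Ub W1.
have : vanishing_in_prob P (fun n w =>
    (kappa n / Num.sqrt (W n w) - 1) * U n w).
  apply: (vanishingM _ Ub) => eps eta eps0 eta0.
  have eps4 : 0 < eps / 4 by rewrite divr_gt0.
  (* [|W - 1| <= 3 / 4] keeps the square root above 1 / 2, where
     [|1 - sqrt W| <= |1 - W|]. *)
  have dlt0 : 0 < Num.min (3 / 4) (eps / 4) :> R.
    by rewrite lt_min eps4 divr_gt0.
  near=> n.
  have kn : `|1 - kappa n| <= eps / 4 by near: n; exact: k1.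
  have WE :
      holds_up_to P [set w | `|W n w - 1| <= Num.min (3 / 4) (eps / 4)] eta.
    by near: n; exact: W1.
  apply: holds_up_toS WE => w /=; rewrite le_min => /andP[W34 Weps].
  have W14 : 4^-1 <= W n w by move: W34; rewrite ler_norml; lra.
  set v := Num.sqrt _.
  have v2 : v ^+ 2 = W n w by rewrite sqr_sqrtr//; lra.
  have v12 : 2^-1 <= v.
    rewrite -[leLHS]ger0_norm ?invr_ge0// -sqrtr_sqr ler_wsqrtr//.
    by rewrite exprVn -natrX.
  have v0 : 0 < v by lra.
  have -> : kappa n / v - 1 = (kappa n - v) / v by field; rewrite gt_eqF.
  rewrite normrM normfV (gtr0_norm v0) ler_pdivrMr//.
  have v1 : `|1 - v| <= `|W n w - 1|.
    rewrite -v2 (_ : v ^+ 2 - 1 = - ((1 - v) * (1 + v))); last by ring.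
    by rewrite normrN normrM ler_peMr// ger0_norm; lra.
  have : `|kappa n - v| <= eps / 2.
    have -> : kappa n - v = - (1 - kappa n) + (1 - v) by ring.
    by apply: le_trans (ler_normD _ _) _; rewrite normrN; lra.
  move/le_trans; apply; rewrite ler_pM2l//.
apply: le_vanishing; near=> n => w.
by rewrite mulrBl mul1r mulrAC.
Unshelve. all: by end_near. Qed.

(** Each residual is [u i] minus the error of the fitted line at [i / n], whose
    square is at most twice the sum of the squared estimation errors.  The
    cross term is split by [2 |a b| <= theta a ^+ 2 + b ^+ 2 / theta], and
    [c i ^+ 2 <= 4 n ^+ 2] is summed over [n] indices. *)
Lemma residual_bound (beta0 beta1 b0 b1 theta : R) (X u c : nat -> R) n :
  (1 <= n)%N -> 0 < theta ->
  (forall i, (1 <= i <= n)%N -> `|c i| <= 2 * n%:R) ->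
  (forall i, X i = beta0 + beta1 * (i%:R / n%:R) + u i) ->
  `|\sum_(1 <= i < n.+1) c i ^+ 2 * (X i - b0 - b1 * (i%:R / n%:R)) ^+ 2
    - \sum_(1 <= i < n.+1) (c i * u i) ^+ 2| <=
  theta * (\sum_(1 <= i < n.+1) (c i * u i) ^+ 2) +
  (1 + theta^-1) * (8 * n%:R ^+ 3 * ((b0 - beta0) ^+ 2 + (b1 - beta1) ^+ 2)).
Proof.
move=> n1 th0 cb XE.
have n0 : 0 < n%:R :> R by rewrite ltr0n.
pose D := 8 * n%:R ^+ 2 * ((b0 - beta0) ^+ 2 + (b1 - beta1) ^+ 2).
have -> : 8 * n%:R ^+ 3 * ((b0 - beta0) ^+ 2 + (b1 - beta1) ^+ 2) =
    \sum_(1 <= i < n.+1) D.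
  by rewrite sumr_const_nat subSS subn0 -mulr_natl /D; ring.
rewrite -sumrB !mulr_sumr -big_split/=.
apply: le_trans (ler_norm_sum _ _ _) _; apply: ler_sum_nat => i /andP[i1 i2].
have i12 : (1 <= i <= n)%N by rewrite i1.
have cn := ler_sqr_norm (cb i i12).
set a := u i.
pose t : R := i%:R / n%:R.
have t0 : 0 <= t by rewrite divr_ge0.
have t1 : t <= 1 by rewrite ler_pdivrMr// mul1r ler_nat.
pose b := (b0 - beta0) + (b1 - beta1) * t.
have -> : X i - b0 - b1 * (i%:R / n%:R) = a - b.
  by rewrite XE /b /t /a; ring.
rewrite [(c i * a) ^+ 2]exprMn.
have c0 : 0 <= c i ^+ 2 by exact: sqr_ge0.
have b2 : b ^+ 2 <= 2 * ((b0 - beta0) ^+ 2 + (b1 - beta1) ^+ 2).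
  have : ((b1 - beta1) * t) ^+ 2 <= (b1 - beta1) ^+ 2.
    by rewrite exprMn ler_piMr ?sqr_ge0// expr_le1.
  move: ((b1 - beta1) * t) (b0 - beta0) @b => q p b qr.
  have pq : b ^+ 2 = 2 * p ^+ 2 + 2 * q ^+ 2 - (p - q) ^+ 2 by rewrite /b; ring.
  have := sqr_ge0 (p - q); rewrite pq; lra.
have cD : c i ^+ 2 * b ^+ 2 <= D.
  rewrite /D (_ : 8 * _ * _ = (2 * n%:R) ^+ 2 *
    (2 * ((b0 - beta0) ^+ 2 + (b1 - beta1) ^+ 2))); last by ring.
  by apply: ler_pM => //; exact: sqr_ge0.
have ab : `|(a - b) ^+ 2 - a ^+ 2| <= theta * a ^+ 2 + (1 + theta^-1) * b ^+ 2.
  have sq0 x : 0 <= theta^-1 * x ^+ 2.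
    by rewrite mulr_ge0 ?sqr_ge0 ?invr_ge0 ?(ltW th0).
  have := sq0 (theta * a + b); have := sq0 (theta * a - b).
  have -> : theta^-1 * (theta * a - b) ^+ 2 =
      theta * a ^+ 2 - 2 * (a * b) + theta^-1 * b ^+ 2 by field; rewrite gt_eqF.
  have -> : theta^-1 * (theta * a + b) ^+ 2 =
      theta * a ^+ 2 + 2 * (a * b) + theta^-1 * b ^+ 2 by field; rewrite gt_eqF.
  have b20 : 0 <= b ^+ 2 by exact: sqr_ge0.
  have -> : (a - b) ^+ 2 - a ^+ 2 = b ^+ 2 - 2 * (a * b) by ring.
  rewrite ler_norml => h1 h2; apply/andP; split; lra.
rewrite -mulrBr normrM (ger0_norm c0).
apply: le_trans (ler_wpM2l c0 ab) _.
rewrite mulrDr mulrCA lerD2l mulrCA ler_wpM2l// addr_ge0// invr_ge0 ltW//.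
Qed.
(** An estimation error is [coef n] times a sum of standard deviation
    [sqrt (a n)], with [coef n = O(n ^- 2)]; hence its square times [n ^+ 3] is
    of order [a n / n]. *)
Lemma scaled_error_vanishing (a b coef : nat -> R) (C : R)
    (U E : nat -> Omega -> R) :
  (\forall n \near \oo, 0 < b n) ->
  (\forall n \near \oo, 0 <= a n) ->
  (\forall n \near \oo, n%:R ^+ 2 * `|coef n| <= C) ->
  a n / (n%:R * b n) @[n --> \oo] --> 0 -> bounded_in_prob P U ->
  (\forall n \near \oo, forall w, E n w = coef n * (Num.sqrt (a n) * U n w)) ->
  vanishing_in_prob P (fun n w => n%:R ^+ 3 * E n w ^+ 2 / b n).
Proof.
move=> b0 a0 coefC ab Ub EE.
have r0 : vanishing_in_prob P
    (fun n w => a n / (n%:R * b n) * (C ^+ 2 * (U n w * U n w))).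
  apply: (vanishingM (vanishing_cst P ab)).
  by apply: (boundedM (bounded_in_prob_cst P _)); exact: boundedM.
apply: le_vanishing r0; near=> n => w.
have bn : 0 < b n by near: n.
have an : 0 <= a n by near: n.
have n0 : 0 < n%:R :> R by rewrite ltr0n; near: n; exact: nbhs_infty_gt.
have gn : n%:R ^+ 2 * `|coef n| <= C by near: n.
have -> : E n w = coef n * (Num.sqrt (a n) * U n w) by move: w; near: n.
have gap2 : n%:R ^+ 4 * coef n ^+ 2 <= C ^+ 2.
  rewrite (_ : _ * _ = (n%:R ^+ 2 * `|coef n|) ^+ 2); last first.
    by rewrite exprMn real_normK ?num_real// -exprM.
  by apply: ler_sqr_norm; rewrite ger0_norm// mulr_ge0// sqr_ge0.
rewrite !exprMn sqr_sqrtr//.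
rewrite (_ : n%:R ^+ 3 * _ / _ =
  (n%:R ^+ 4 * coef n ^+ 2) * (a n / (n%:R * b n) * U n w ^+ 2)); last first.
  by field; rewrite !gt_eqF.
rewrite (_ : a n / _ * (C ^+ 2 * _) =
  C ^+ 2 * (a n / (n%:R * b n) * U n w ^+ 2)); last by ring.
rewrite [leLHS]normrM [leRHS]normrM; apply: ler_wpM2r; first exact: normr_ge0.
rewrite (ger0_norm (sqr_ge0 C)) ger0_norm//.
by apply: mulr_ge0; [apply: exprn_ge0; exact: ltW|exact: sqr_ge0].
Unshelve. all: by end_near. Qed.
End Residuals.

(** * Self-normalized estimation errors for one weight *)

Section Studentization.
Context (R : realType).

(** The three terms of the condition are nonnegative, so each one tends to 0.
    The last two are stated for the array of squares, to which the results on
    weighted sums will be applied. *)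
Lemma array_condition_split (s : nat -> nat -> R) :
  array_condition s rate ->
  [/\ array_variation (s n) n * rate n / Sigma (s n) n @[n --> \oo] --> (0 : R),
      array_variation (fun i => s n i ^+ 2) n * rate n / Sigma_sq (s n) n
        @[n --> \oo] --> (0 : R) &
      Sigma (fun i => s n i ^+ 2) n / Sigma_sq (s n) n
        @[n --> \oo] --> (0 : R)].
Proof.
move=> cond.
have starE n : Sigma_star_sq (s n) n = Sigma (fun i => s n i ^+ 2) n.
  rewrite /Sigma_star_sq /Sigma /Sigma_sq; congr Num.sqrt.
  by apply: eq_bigr => i _; rewrite -exprM.
have V0 (u : nat -> R) n : 0 <= array_variation u n.
  by rewrite addr_ge0// sumr_ge0.
have r0 : \forall n \near \oo, 0 <= rate n :> R.
  near=> n; apply/ltW/rate_gt0; near: n; exact: nbhs_infty_ge.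
have bounds : \forall n \near \oo,
  let t1 := array_variation (s n) n * rate n / Sigma (s n) n in
  let t2 :=
    array_variation (fun i => s n i ^+ 2) n * rate n / Sigma_sq (s n) n in
  let t3 := Sigma (fun i => s n i ^+ 2) n / Sigma_sq (s n) n in
  [/\ 0 <= t1, 0 <= t2, 0 <= t3 &
    array_variation (s n) n * rate n / Sigma (s n) n +
     (array_variation_sq (s n) n * rate n + Sigma_star_sq (s n) n)
       / Sigma_sq (s n) n = t1 + t2 + t3].
  apply: filterS r0 => n rn t1 t2 t3; split.
  - by apply: divr_ge0; [exact: mulr_ge0|exact: sqrtr_ge0].
  - by apply: divr_ge0; [exact: mulr_ge0|exact: Sigma_sq_ge0].
  - by apply: divr_ge0; [exact: sqrtr_ge0|exact: Sigma_sq_ge0].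
  - by rewrite starE -[RHS]addrA -mulrDl.
split; apply: (squeeze_cvgr _ (cvg_cst 0) cond);
  apply: filterS bounds => n [t1 t2 t3 ->]; apply/andP; split=> //; lra.
Unshelve. all: by end_near. Qed.

Lemma cvg_to_one (kappa : nat -> R) :
  (\forall n \near \oo, `|1 - kappa n| <= 2 / n%:R) ->
  kappa n @[n --> \oo] --> (1 : R).
Proof.
move=> k1; apply/cvgrPdist_le => eps eps0; near=> n.
apply: (@le_trans _ _ (2 / n%:R)); first by near: n.
have n0 : 0 < n%:R :> R by rewrite ltr0n; near: n; exact: nbhs_infty_gt.
rewrite ler_pdivrMr// mulrC -ler_pdivrMr//.
by near: n; exact: nbhs_infty_ger.
Unshelve. all: by end_near. Qed.

Section Measurability.
Context d (Omega : measurableType d) (X : Omega -> nat -> R).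
Hypothesis mX : forall i, measurable_fun setT (fun w => X w i).

Lemma measurable_slope_estimate n :
  measurable_fun setT (fun w => slope_estimate (X w) n).
Proof.
apply: measurable_funM => //.
apply: measurable_funB; apply: measurable_funM => //.
  by apply: measurable_sum => i; apply: measurable_funM.
exact: measurable_sum.
Qed.

Lemma measurable_intercept_estimate n :
  measurable_fun setT (fun w => intercept_estimate (X w) n).
Proof.
apply: measurable_funB; apply: measurable_funM => //.
  exact: measurable_sum.
exact: measurable_slope_estimate.
Qed.

(** The inverse of a square root is the power of exponent [- 1 / 2], also at 0
    where both are 0. *)
Lemma measurable_self_normalizer_inv c n :
  measurable_fun setT (fun w => (self_normalizer c (X w) n)^-1).
Proof.
pose V w := \sum_(1 <= i < n.+1) c n i ^+ 2 *
  (X w i - intercept_estimate (X w) n -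
   slope_estimate (X w) n * (i%:R / n%:R)) ^+ 2.
rewrite (_ : (fun _ => _) = fun w => V w `^ (- 2^-1)); last first.
  apply/funext => w; rewrite powRN powR12_sqrt//.
  by apply: sumr_ge0 => i _; apply: mulr_ge0; exact: sqr_ge0.
apply: (measurableT_comp (measurable_powR _)).
apply: measurable_sum => i; apply: measurable_funM => //.
apply: measurable_funX; apply: measurable_funB; last first.
  by apply: measurable_funM => //; exact: measurable_slope_estimate.
by apply: measurable_funB => //; exact: measurable_intercept_estimate.
Qed.
End Measurability.

Context d (Omega : measurableType d) (P : probability Omega R).
Variables (e : nat -> {RV P >-> R}) (beta0 beta1 : R) (sigma : nat -> nat -> R).
Variables (tau tau_star : R).
Hypotheses (tau_gt0 : 0 < tau) (sip : strong_invariance e id tau rate)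
  (sip_star : strong_invariance e (fun x => x ^+ 2 - 1) tau_star rate).
Let X := regression_model beta0 beta1 sigma e.
Let err n w := (intercept_estimate (X n w) n - beta0) ^+ 2 +
               (slope_estimate (X n w) n - beta1) ^+ 2.

Lemma measurable_regression_model n i : measurable_fun setT (fun w => X n w i).
Proof.
by apply: measurable_funD => //; apply: measurable_funM.
Qed.

Section OneWeight.
Variable c : nat -> nat -> R.
Let s n i := c n i * sigma n i.
Hypothesis s_gt0 : \forall n \near \oo, 0 < Sigma_sq (s n) n.
Hypothesis condition : array_condition s rate.
Let U n w := (\sum_(1 <= i < n.+1) s n i * e i w) / Sigma (s n) n.

Lemma weighted_noise_normal :
  cvg_levy (normal_prob 0 tau) P U /\ bounded_in_prob P U.
Proof.
have [V0 _ _] := array_condition_split condition.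
exact: (weighted_sum_normal (f := id)).
Qed.

(** The weighted sum of [e i ^+ 2 - 1] with weights [s i ^+ 2], normalized by
    [Sigma_sq], which dominates the standard deviation of its Gaussian
    approximation. *)
Lemma weighted_squares_vanishing : vanishing_in_prob P (fun n w =>
  (\sum_(1 <= i < n.+1) (s n i * e i w) ^+ 2) / Sigma_sq (s n) n - 1).
Proof.
have [_ V0 S0] := array_condition_split condition.
have s2_gt0 : \forall n \near \oo, 0 < Sigma_sq (fun i => s n i ^+ 2) n.
  apply: filterS s_gt0 => n; rewrite /Sigma_sq lt_def psumr_neq0 => [|i _].
    move=> /andP[/hasP[i + /= si] _]; rewrite mem_index_iota ltnS => i1n.
    by apply: (Sigma_sq_gt0 i1n); rewrite gt_eqF.
  exact: sqr_ge0.
have mf : measurable_fun setT (fun x : R => x ^+ 2 - 1).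
  by apply: measurable_funB => //; exact: measurable_funX.
apply: le_vanishing (weighted_sum_vanishing mf s2_gt0 sip_star s_gt0 V0 S0).
apply: filterS s_gt0 => n sn w.
rewrite -{1}(divff (lt0r_neq0 sn)) -mulrBl -sumrB.
by under eq_bigr do rewrite exprMn -{2}[s n _ ^+ 2]mulr1 -mulrBr.
Qed.

Hypothesis c_bound :
  forall n i, (1 <= i <= n)%N -> `|c n i| <= 2 * n%:R.
Hypothesis err_vanishing :
  vanishing_in_prob P (fun n w => n%:R ^+ 3 * err n w / Sigma_sq (s n) n).
Variables (kappa : nat -> R) (est : nat -> Omega -> R).
Hypothesis kappa1 : kappa n @[n --> \oo] --> (1 : R).
Hypothesis mest : forall n, measurable_fun setT (est n).
Hypothesis estE : \forall n \near \oo, forall w,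
  est n w = kappa n * \sum_(1 <= i < n.+1) s n i * e i w.

(** By [residual_bound], the squared self-normalizer differs from the weighted
    sum of squares of the noise by [theta] times that sum, up to a term that
    vanishes with the estimation errors. *)
Lemma self_normalizer_ratio_vanishing : vanishing_in_prob P (fun n w =>
  self_normalizer c (X n w) n ^+ 2 / Sigma_sq (s n) n - 1).
Proof.
pose Q n w := (\sum_(1 <= i < n.+1) (s n i * e i w) ^+ 2) / Sigma_sq (s n) n.
have Q1 : vanishing_in_prob P (fun n w => Q n w - 1).
  exact: weighted_squares_vanishing.
have Qb : bounded_in_prob P Q.
  have := boundedD_vanishing (bounded_in_prob_cst P 1) Q1.
  congr bounded_in_prob; apply/funext => n; apply/funext => w.
  by rewrite addrC subrK.
have VQ : vanishing_in_prob P (fun n w =>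
    self_normalizer c (X n w) n ^+ 2 / Sigma_sq (s n) n - Q n w).
  apply: (vanishing_relative Qb) => theta th0.
  exists (fun n w =>
      (n%:R ^+ 3 * err n w / Sigma_sq (s n) n) * ((1 + theta^-1) * 8)).
    exact: (vanishingM err_vanishing (bounded_in_prob_cst P _)).
  near=> n => w.
  have sn : 0 < Sigma_sq (s n) n by near: n.
  have n1 : (1 <= n)%N by near: n; exact: nbhs_infty_ge.
  rewrite /self_normalizer sqr_sqrtr; last first.
    by apply: sumr_ge0 => i _; apply: mulr_ge0; exact: sqr_ge0.
  have := @residual_bound R beta0 beta1 (intercept_estimate (X n w) n)
    (slope_estimate (X n w) n) theta (X n w) (fun i => sigma n i * e i w)
    (c n) n n1 th0 (@c_bound n) (fun i => erefl).
  set VV := \sum_(_ <= _ < _) _; set N := \sum_(_ <= _ < _) _ => VN.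
  have QE : Q n w = N / Sigma_sq (s n) n.
    rewrite /Q /N; congr (_ / _); apply: eq_bigr => i _.
    by rewrite /s mulrA.
  rewrite QE -mulrBl normrM [`|_^-1|]gtr0_norm ?invr_gt0//.
  apply: (@le_trans _ _ (theta * (N / Sigma_sq (s n) n) +
    n%:R ^+ 3 * err n w / Sigma_sq (s n) n * ((1 + theta^-1) * 8))); last first.
    by apply: lerD; [rewrite ler_pM2l//|]; exact: ler_norm.
  rewrite ler_pdivrMr//; apply: le_trans VN _.
  rewrite le_eqVlt; apply/orP; left.
  by apply/eqP; rewrite /err; field; rewrite !gt_eqF.
have := vanishingD VQ Q1.
congr vanishing_in_prob; apply/funext => n; apply/funext => w.
by rewrite addrA subrK.
Unshelve. all: by end_near. Qed.

(** [est] is the weighted noise up to a factor tending to 1, so that dividing by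
    [Sigma] instead of the self-normalizer would give a normal limit; the
    quotient of these two normalizations tends to 1 in probability. *)
Lemma studentized_limit : cvg_in_distribution P
  (fun n w => est n w / self_normalizer c (X n w) n) (normal_prob 0 tau).
Proof.
have mU n : measurable_fun setT (U n).
  apply: measurable_funM => //; apply: measurable_sum => i.
  by apply: measurable_funM => //; exact: (@measurable_funPT _ _ _ _ (e i)).
have mY n : measurable_fun setT
    (fun w => est n w / self_normalizer c (X n w) n).
  apply: measurable_funM => //; apply: measurable_self_normalizer_inv => i.
  exact: measurable_regression_model.
have [U_levy U_bounded] := weighted_noise_normal.
apply: (cvg_levy_in_distribution mY (mu := normal_prob 0 tau)).
apply: (cvg_levy_vanishing mU mY _ U_levy).
apply: le_vanishing
  (studentized_vanishing kappa1 U_bounded self_normalizer_ratio_vanishing).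
near=> n => w.
have sn : 0 < Sigma_sq (s n) n by near: n.
have -> : est n w = kappa n * \sum_(1 <= i < n.+1) s n i * e i w.
  by move: w; near: n.
rewrite sqrtrM ?sqr_ge0// sqrtr_sqr.
rewrite [`|self_normalizer _ _ _|]ger0_norm ?sqrtr_ge0//.
have Sn : 0 < Sigma (s n) n by rewrite sqrtr_gt0.
rewrite sqrtrV; last exact: ltW.
rewrite -/(Sigma (s n) n) /U invfM invrK.
set v := (self_normalizer _ _ _)^-1.
rewrite [X in _ <= `|X - _|](_ : _ =
  kappa n * (\sum_(1 <= i < n.+1) s n i * e i w) * v)//.
by field; rewrite gt_eqF.
Unshelve. all: by end_near. Qed.
End OneWeight.
End Studentization.

(** * Deterministic factors and the limit theorem *)

Section Coefficients.
Context (R : realType).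

Lemma intercept_coef_bound n : (2 <= n)%N ->
  n%:R ^+ 2 * `|2 / (n%:R * (n%:R - 1))| <= 4 :> R.
Proof.
rewrite -(ler_nat R) => n2.
have p : 0 < n%:R * (n%:R - 1) :> R by rewrite mulr_gt0; lra.
rewrite ger0_norm; last by rewrite divr_ge0// ltW.
rewrite mulrA ler_pdivrMr//.
have : 0 <= n%:R * (n%:R - 2) :> R by rewrite mulr_ge0; lra.
lra.
Qed.

Lemma slope_coef_bound n : (2 <= n)%N ->
  n%:R ^+ 2 * `|6 / (n%:R ^+ 2 - 1)| <= 12 :> R.
Proof.
rewrite -(ler_nat R) => n2.
have n4 : 4 <= n%:R ^+ 2 :> R.
  have : 0 <= (n%:R - 2) * (n%:R + 2) :> R by rewrite mulr_ge0; lra.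
  lra.
have p : 0 < n%:R ^+ 2 - 1 :> R by lra.
rewrite ger0_norm; last by rewrite divr_ge0// ltW.
rewrite mulrA ler_pdivrMr//; lra.
Qed.

Lemma intercept_factor_near1 n : (2 <= n)%N ->
  `|1 - n%:R ^+ 2 / 2 * (2 / (n%:R * (n%:R - 1)))| <= 2 / n%:R :> R.
Proof.
rewrite -(ler_nat R) => n2.
have n1 : 0 < n%:R - 1 :> R by lra.
have n0 : 0 < n%:R :> R by lra.
rewrite (_ : 1 - _ = - (n%:R - 1)^-1); last by field; rewrite !gt_eqF.
rewrite normrN normfV gtr0_norm// ler_pdivlMr// mulrC ler_pdivrMr//; lra.
Qed.

Lemma slope_factor_near1 n : (2 <= n)%N ->
  `|1 - n%:R ^+ 2 / 6 * (6 / (n%:R ^+ 2 - 1))| <= 2 / n%:R :> R.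
Proof.
rewrite -(ler_nat R) => n2.
have n0 : 0 < n%:R :> R by lra.
have nn : 0 <= n%:R * (n%:R - 2) :> R by rewrite mulr_ge0; lra.
have n1 : 0 < n%:R ^+ 2 - 1 :> R by lra.
rewrite (_ : 1 - _ = - (n%:R ^+ 2 - 1)^-1); last by field; rewrite gt_eqF.
rewrite normrN normfV gtr0_norm// ler_pdivlMr// mulrC ler_pdivrMr//; lra.
Qed.
End Coefficients.

Theorem theorem2p5 (R : realType) (d : measure_display)
    (Omega : measurableType d) (P : probability Omega R)
    (e : nat -> {RV P >-> R}) (beta0 beta1 : R) (sigma : nat -> nat -> R)
    (tau tau_star : R)
    (e_stationary : strictly_stationary e)
    (e_mean : forall i, (1 <= i)%N -> ('E_P[e i] = 0)%E)
    (e_variance : forall i, (1 <= i)%N ->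
       ('E_P[fun w => (e i w ^+ 2)%R] = 1)%E)
    (sigma_gt0 : forall n i, (1 <= i <= n)%N -> 0 < sigma n i)
    (tau_gt0 : 0 < tau) (tau_star_ge0 : 0 <= tau_star)
    (tau_lrv : is_long_run_variance P e (tau ^+ 2))
    (tau_star_lrv :
       is_long_run_variance P (fun i w => e i w ^+ 2 - 1) (tau_star ^+ 2))
    (sip : strong_invariance e id tau rate)
    (sip_star : strong_invariance e (fun x => x ^+ 2 - 1) tau_star rate)
    (condition0 :
       array_condition (fun n i => intercept_weight n i * sigma n i) rate)
    (condition1 :
       array_condition (fun n i => slope_weight n i * sigma n i) rate) :
  let X := regression_model beta0 beta1 sigma e in
  cvg_in_distribution P
    (fun n w => n%:R ^+ 2 * (intercept_estimate (X n w) n - beta0)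
                / (2 * self_normalizer intercept_weight (X n w) n))
    (normal_prob 0 tau) /\
  cvg_in_distribution P
    (fun n w => n%:R ^+ 2 * (slope_estimate (X n w) n - beta1)
                / (6 * self_normalizer slope_weight (X n w) n))
    (normal_prob 0 tau).
Proof.
move=> X.
have n2 : \forall n \near \oo, (2 <= n)%N by exact: nbhs_infty_ge.
pose s0 n i := intercept_weight n i * sigma n i.
pose s1 n i := slope_weight n i * sigma n i.
have s0_gt0 : \forall n \near \oo, 0 < Sigma_sq (s0 n) n.
  apply: filterS n2 => n n2; apply: (@Sigma_sq_gt0 _ _ _ 1).
    by rewrite (ltnW n2).
  rewrite mulf_neq0 ?gt_eqF ?sigma_gt0 ?(ltnW n2)//.
  by move: n2; rewrite -(ler_nat R) /intercept_weight => n2; lra.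
have s1_gt0 : \forall n \near \oo, 0 < Sigma_sq (s1 n) n.
  apply: filterS n2 => n n2; apply: (@Sigma_sq_gt0 _ _ _ n).
    by rewrite leqnn (ltnW n2).
  rewrite mulf_neq0 ?gt_eqF ?sigma_gt0 ?leqnn ?(ltnW n2)//.
  by move: n2; rewrite -(ler_nat R) /slope_weight => n2; lra.
have [_ U0_bounded] := weighted_noise_normal tau_gt0 sip s0_gt0 condition0.
have [_ U1_bounded] := weighted_noise_normal tau_gt0 sip s1_gt0 condition1.
have [V0 _ _] := array_condition_split condition0.
have [V1 _ _] := array_condition_split condition1.
have le23 : 2 <= 3 :> R by lra.
have le22 : 2 <= 2 :> R by lra.
have r01 :
    Sigma_sq (s0 n) n / (n%:R * Sigma_sq (s1 n) n) @[n --> \oo] --> (0 : R).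
  apply: (Sigma_sq_ratio le22 _ _ s0_gt0 s1_gt0 V0).
  - exact: intercept_weight_bound.
  - by move=> n i _; exact: slope_weight_affine.
have r10 :
    Sigma_sq (s1 n) n / (n%:R * Sigma_sq (s0 n) n) @[n --> \oo] --> (0 : R).
  apply: (Sigma_sq_ratio le23 _ _ s1_gt0 s0_gt0 V1).
  - exact: slope_weight_bound.
  - by move=> n i _; exact: intercept_weight_affine.
have estimates := regression_estimates beta0 beta1 sigma e.
(* Fitting the line perturbs the residuals through both estimation errors, so
   each weight has to dominate the errors attached to both of them. *)
have err (c : nat -> nat -> R) :
    let s n i := c n i * sigma n i in
    (\forall n \near \oo, 0 < Sigma_sq (s n) n) ->
    Sigma_sq (s0 n) n / (n%:R * Sigma_sq (s n) n) @[n --> \oo] --> (0 : R) ->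
    Sigma_sq (s1 n) n / (n%:R * Sigma_sq (s n) n) @[n --> \oo] --> (0 : R) ->
    vanishing_in_prob P (fun n w => n%:R ^+ 3 *
      ((intercept_estimate (X n w) n - beta0) ^+ 2 +
       (slope_estimate (X n w) n - beta1) ^+ 2) / Sigma_sq (s n) n).
  move=> s s_gt0 r0 r1.
  have nonneg (t : nat -> nat -> R) :
      \forall n \near \oo, 0 <= Sigma_sq (t n) n.
    by apply: nearW => n; exact: Sigma_sq_ge0.
  have E0 : vanishing_in_prob P (fun n w =>
      n%:R ^+ 3 * (intercept_estimate (X n w) n - beta0) ^+ 2 /
      Sigma_sq (s n) n).
    apply: (scaled_error_vanishing (coef := fun n => 2 / (n%:R * (n%:R - 1)))
      (C := 4) s_gt0 (nonneg s0) _ r0 U0_bounded).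
      by apply: filterS n2 => n; exact: intercept_coef_bound.
    apply: filterS2 n2 s0_gt0 => n n2' sn w.
    have [-> _] := estimates _ w n2'; congr (_ * _).
    by rewrite mulrC divfK// gt_eqF// sqrtr_gt0.
  have E1 : vanishing_in_prob P (fun n w =>
      n%:R ^+ 3 * (slope_estimate (X n w) n - beta1) ^+ 2 / Sigma_sq (s n) n).
    apply: (scaled_error_vanishing (coef := fun n => 6 / (n%:R ^+ 2 - 1))
      (C := 12) s_gt0 (nonneg s1) _ r1 U1_bounded).
      by apply: filterS n2 => n; exact: slope_coef_bound.
    apply: filterS2 n2 s1_gt0 => n n2' sn w.
    have [_ ->] := estimates _ w n2'; congr (_ * _).
    by rewrite mulrC divfK// gt_eqF// sqrtr_gt0.
  have := vanishingD E0 E1.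
  congr vanishing_in_prob; apply/funext => n; apply/funext => w.
  by rewrite mulrDr mulrDl.
have mX n i : measurable_fun setT (fun w => X n w i).
  exact: measurable_regression_model.
split.
- rewrite (_ : (fun n w => _) = fun n w =>
    n%:R ^+ 2 * (intercept_estimate (X n w) n - beta0) / 2 /
    self_normalizer intercept_weight (X n w) n); last first.
    by apply/funext => n; apply/funext => w; rewrite invfM mulrA.
  apply: (studentized_limit tau_gt0 sip sip_star s0_gt0 condition0
    (@intercept_weight_bound R) (err _ s0_gt0 (Sigma_sq_self_ratio s0_gt0) r10)
    (est := fun n w => n%:R ^+ 2 * (intercept_estimate (X n w) n - beta0) / 2)
    (kappa := fun n => n%:R ^+ 2 / 2 * (2 / (n%:R * (n%:R - 1))))).
  + by apply: cvg_to_one; apply: filterS n2 => n; exact: intercept_factor_near1.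
  + move=> n; apply: measurable_funM => //; apply: measurable_funM => //.
    by apply: measurable_funB => //; exact: measurable_intercept_estimate.
  + apply: filterS n2 => n n2' w; have [-> _] := estimates _ w n2'.
    by ring.
- rewrite (_ : (fun n w => _) = fun n w =>
    n%:R ^+ 2 * (slope_estimate (X n w) n - beta1) / 6 /
    self_normalizer slope_weight (X n w) n); last first.
    by apply/funext => n; apply/funext => w; rewrite invfM mulrA.
  apply: (studentized_limit tau_gt0 sip sip_star s1_gt0 condition1
    (@slope_weight_bound R) (err _ s1_gt0 r01 (Sigma_sq_self_ratio s1_gt0))
    (est := fun n w => n%:R ^+ 2 * (slope_estimate (X n w) n - beta1) / 6)
    (kappa := fun n => n%:R ^+ 2 / 6 * (6 / (n%:R ^+ 2 - 1)))).
  + by apply: cvg_to_one; apply: filterS n2 => n; exact: slope_factor_near1.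
  + move=> n; apply: measurable_funM => //; apply: measurable_funM => //.
    by apply: measurable_funB => //; exact: measurable_slope_estimate.
  + apply: filterS n2 => n n2' w; have [_ ->] := estimates _ w n2'.
    by ring.
Qed.
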